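(* Let $K$ be a transition matrix on $\mathcal X=\{0,1,\dots,N\}$ generated by one of the convolutions listed in the context from measures of one family (Krawtchouk, Hahn or $q$-Hahn), and suppose that for some admissible parameter $\lambda$ of the same family $K(x,y)\,\pi(y,N,\lambda)=K(y,x)\,\pi(x,N,\lambda)$ for all $x,y\in\mathcal X$. Let $\hat\phi_n(x)=d_n\hat\phi_0(x)\check P_n(x,\lambda)$ with $\hat\phi_0(x)=\sqrt{\pi(x,N,\lambda)}$, let $\mathcal H(x,y)=\frac{\hat\phi_0(y)}{\hat\phi_0(x)}K(x,y)$ (a real symmetric matrix), and let $\kappa(n)$ be the eigenvalue of $K$ belonging to the eigenvector $\pi(x,N,\lambda)\check P_n(x,\lambda)$. Then the spectral representation of $\mathcal H$ provides that of $K$: for all $x,y\in\mathcal X$, $$\mathcal H(x,y)=\sum_{n\in\mathcal X}\kappa(n)\,\hat\phi_n(x)\,\hat\phi_n(y),$$ $$K(x,y)=\hat\phi_0(x)\sum_{n\in\mathcal X}\kappa(n)\,\hat\phi_n(x)\,\hat\phi_n(y)\cdot\hat\phi_0(y)^{-1}=\sum_{n\in\mathcal X}\kappa(n)\,d_n^2\,\pi(x,N,\lambda)\,\check P_n(x,\lambda)\,\check P_n(y,\lambda).$$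
   Context: Notation: $N\ge1$ integer, $(a)_n=a(a+1)\cdots(a+n-1)$, $(a;q)_n=\prod_{i=0}^{n-1}(1-aq^i)$, $0<q<1$ fixed. Measures $\pi(x,M,\lambda)$ for integers $0\le x\le M$ (zero for other integer arguments), and polynomials $\check P_n(x,\lambda)$, $n,x\in\mathcal X$ (normalised by $\check P_0(x)=1$, $\check P_n(0)=1$): - Krawtchouk, $\lambda=p$, $0<p<1$: $\pi(x,M,p)=\binom{M}{x}p^x(1-p)^{M-x}$; $\check P_n(x,p)=\sum_{k=0}^n\frac{(-n)_k(-x)_k}{(-N)_k\,k!}p^{-k}$. - Hahn, $\lambda=(a,b)$, $a,b>0$: $\pi(x,M,a,b)=\binom{M}{x}\frac{(a)_x(b)_{M-x}}{(a+b)_M}$; $\check P_n(x,a,b)=\sum_{k=0}^n\frac{(-n)_k(n+a+b-1)_k(-x)_k}{(a)_k(-N)_k\,k!}$. - $q$-Hahn, $\lambda=(a,b)$, $0<a<1$, $b<1$: $\pi(x,M,a,b)=\frac{(q;q)_M}{(q;q)_x(q;q)_{M-x}}\frac{(a;q)_x(b;q)_{M-x}a^{M-x}}{(ab;q)_M}$; $\check P_n(x,a,b)=\sum_{k=0}^n\frac{(q^{-n};q)_k(abq^{n-1};q)_k(q^{-x};q)_k}{(a;q)_k(q^{-N};q)_k(q;q)_k}q^k$. The constants $d_n>0$ are defined by $\sum_{x\in\mathcal X}\pi(x,N,\lambda)\check P_m(x,\lambda)\check P_n(x,\lambda)=\delta_{m,n}/d_n^2$, so that $\{\hat\phi_n\}$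 is orthonormal. In this setting each $\pi(x,N,\lambda)\check P_n(x,\lambda)$ is a right eigenvector of $K$: $\sum_{y}K(x,y)\pi(y,N,\lambda)\check P_n(y,\lambda)=\kappa(n)\pi(x,N,\lambda)\check P_n(x,\lambda)$, which defines $\kappa(n)$. Convolutions ($x,y\in\mathcal X$; $\lambda_1,\lambda_2,\lambda_3$ admissible parameters of the family; (i)–(v) allowed for Krawtchouk and Hahn, (i), (iii), (iv) for $q$-Hahn): (i) $K(x,y)=\sum_{z=0}^{\min(x,y)}\pi(x-z,N-z,\lambda_2)\,\pi(z,y,\lambda_1)$; (ii) $K(x,y)=\sum_{z=\max(0,x+y-N)}^{\min(x,y)}\pi(x-z,N-y,\lambda_2)\,\pi(z,y,\lambda_1)$; (iii) $K(x,y)=\sum_{z=\max(x,y)}^{N}\pi(x,z,\lambda_2)\,\pi(z-y,N-y,\lambda_1)$; (iv) $K(x,y)=\sum_{z_2=0}^{\min(x,y)}\pi(z_2,y,\lambda_1)\sum_{z_1=\max(x,y)}^{N}\pi(x-z_2,z_1-z_2,\lambda_3)\,\pi(z_1-y,N-y,\lambda_2)$; (v) $K(x,y)=\sum_{z_2=0}^{\min(x,y)}\pi(z_2,y,\lambda_1)\sum_{z_1=x+y-z_2}^{N}\pi(x-z_2,z_1-y,\lambda_3)\,\pi(z_1-y,N-y,\lambda_2)$. *)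

(* Defs.v *)
From HB Require Import structures.
From mathcomp Require Import all_boot all_order all_algebra.
From mathcomp Require Import all_classical all_reals.

Set Implicit Arguments.
Unset Strict Implicit.
Unset Printing Implicit Defensive.

Import Order.TTheory GRing.Theory Num.Theory.

Local Open Scope ring_scope.

Section Symbols.
Variable R : realType.

Definition poch (a : R) (n : nat) : R := \prod_(i < n) (a + i%:R).

Definition qpoch (a q : R) (n : nat) : R := \prod_(i < n) (1 - a * q ^+ i).

End Symbols.

Inductive ortho_family := Krawtchouk | Hahn | QHahn.

Section Families.
Variables (R : realType) (q : R).

Definition fparam (F : ortho_family) : Type :=
  match F with
  | Krawtchouk => R
  | Hahn | QHahn => (R * R)%type
  end.

Definition admissible (F : ortho_family) : fparam F -> Prop :=
  match F return fparam F -> Prop with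
  | Krawtchouk => fun p => 0 < p < 1
  | Hahn => fun l => 0 < l.1 /\ 0 < l.2
  | QHahn => fun l => 0 < l.1 < 1 /\ l.2 < 1
  end.

(* The guard matters: for x > M the truncated difference M - x would give junk
   instead of the value zero. *)
Definition pi_meas (F : ortho_family) (x M : nat) : fparam F -> R :=
  match F return fparam F -> R with
  | Krawtchouk => fun p =>
      if (x <= M)%N then 'C(M, x)%:R * p ^+ x * (1 - p) ^+ (M - x) else 0
  | Hahn => fun l => let: (a, b) := l in
      if (x <= M)%N
      then 'C(M, x)%:R * (poch a x * poch b (M - x) / poch (a + b) M)
      else 0
  | QHahn => fun l => let: (a, b) := l in
      if (x <= M)%N
      then qpoch q q M / (qpoch q q x * qpoch q q (M - x))
           * (qpoch a q x * qpoch b q (M - x) * a ^+ (M - x)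
              / qpoch (a * b) q M)
      else 0
  end.

Definition Pcheck (F : ortho_family) (N n x : nat) : fparam F -> R :=
  match F return fparam F -> R with
  | Krawtchouk => fun p =>
      \sum_(k < n.+1) poch (- n%:R) k * poch (- x%:R) k
        / (poch (- N%:R) k * k`!%:R) * p ^- k
  | Hahn => fun l => let: (a, b) := l in
      \sum_(k < n.+1) poch (- n%:R) k * poch (n%:R + a + b - 1) k
          * poch (- x%:R) k
        / (poch a k * poch (- N%:R) k * k`!%:R)
  | QHahn => fun l => let: (a, b) := l in
      \sum_(k < n.+1) qpoch (q ^- n) q k * qpoch (a * b * q ^+ n / q) q k
          * qpoch (q ^- x) q k
        / (qpoch a q k * qpoch (q ^- N) q k * qpoch q q k) * q ^+ k
  end.

End Families.

Arguments pi_meas {R} q {F} x M _.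
Arguments Pcheck {R} q {F} N n x _.
Arguments admissible {R F} _.

Section Chains.
Variables (R : realType) (q : R) (F : ortho_family) (N : nat).
Local Notation fparam := (fparam R F).
Local Notation pi_ := (@pi_meas R q F).
Local Notation X := 'I_N.+1.

(* Every subtraction of naturals below is exact on its summation range, except
   x + y - N in conv2, where truncation realises max(0, x + y - N). *)

Definition conv1 (l1 l2 : fparam) : 'M[R]_N.+1 := \matrix_(x, y)
  \sum_(0 <= z < (minn x y).+1) pi_ (x - z)%N (N - z)%N l2 * pi_ z y l1.

Definition conv2 (l1 l2 : fparam) : 'M[R]_N.+1 := \matrix_(x, y)
  \sum_((x + y - N)%N <= z < (minn x y).+1)
    pi_ (x - z)%N (N - y)%N l2 * pi_ z y l1.

Definition conv3 (l1 l2 : fparam) : 'M[R]_N.+1 := \matrix_(x, y)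
  \sum_(maxn x y <= z < N.+1) pi_ x z l2 * pi_ (z - y)%N (N - y)%N l1.

Definition conv4 (l1 l2 l3 : fparam) : 'M[R]_N.+1 := \matrix_(x, y)
  \sum_(0 <= z2 < (minn x y).+1) pi_ z2 y l1 *
    \sum_(maxn x y <= z1 < N.+1)
      pi_ (x - z2)%N (z1 - z2)%N l3 * pi_ (z1 - y)%N (N - y)%N l2.

Definition conv5 (l1 l2 l3 : fparam) : 'M[R]_N.+1 := \matrix_(x, y)
  \sum_(0 <= z2 < (minn x y).+1) pi_ z2 y l1 *
    \sum_((x + y - z2)%N <= z1 < N.+1)
      pi_ (x - z2)%N (z1 - y)%N l3 * pi_ (z1 - y)%N (N - y)%N l2.

Inductive generated : 'M[R]_N.+1 -> Prop :=
  | Generated1 l1 l2 : admissible l1 -> admissible l2 ->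
      generated (conv1 l1 l2)
  | Generated2 l1 l2 : F <> QHahn -> admissible l1 -> admissible l2 ->
      generated (conv2 l1 l2)
  | Generated3 l1 l2 : admissible l1 -> admissible l2 ->
      generated (conv3 l1 l2)
  | Generated4 l1 l2 l3 : admissible l1 -> admissible l2 -> admissible l3 ->
      generated (conv4 l1 l2 l3)
  | Generated5 l1 l2 l3 : F <> QHahn ->
      admissible l1 -> admissible l2 -> admissible l3 ->
      generated (conv5 l1 l2 l3).

Definition detailed_balance (K : 'M[R]_N.+1) (l : fparam) : Prop :=
  forall x y : X, K x y * pi_ y N l = K y x * pi_ x N l.

(* d_n and kappa(n) are definite descriptions: the real number satisfying the
   defining relation. That such a number exists (the orthogonality of the
   polynomials, resp. the eigenvector property) is not built in; the default
   value 0 carries no information. *)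
Definition dn (l : fparam) (n : X) : R :=
  xget 0 [set c : R | 0 < c /\
    forall m : X,
      \sum_(x : X) pi_ x N l * Pcheck q N m x l * Pcheck q N n x l
      = (m == n)%:R / c ^+ 2]%classic.

Definition kappa (K : 'M[R]_N.+1) (l : fparam) (n : X) : R :=
  xget 0 [set k : R |
    forall x : X,
      \sum_(y : X) K x y * (pi_ y N l * Pcheck q N n y l)
      = k * (pi_ x N l * Pcheck q N n x l)]%classic.

Definition phi0 (l : fparam) (x : X) : R := Num.sqrt (pi_ x N l).

Definition phi (l : fparam) (n x : X) : R :=
  dn l n * phi0 l x * Pcheck q N n x l.

Definition Hmat (K : 'M[R]_N.+1) (l : fparam) : 'M[R]_N.+1 :=
  \matrix_(x, y) (phi0 l y / phi0 l x * K x y).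

End Chains.

Arguments generated {R} q F {N} _.
Arguments detailed_balance {R} q {F N} K l.
Arguments dn {R} q {F N} l n.
Arguments kappa {R} q {F N} K l n.
Arguments phi0 {R} q {F N} l x.
Arguments phi {R} q {F N} l n x.
Arguments Hmat {R} q {F N} K l.

(* Main.v *)
Require Import Defs.
From HB Require Import structures.
From mathcomp Require Import all_boot all_order all_algebra.
From mathcomp Require Import all_classical all_reals.
From mathcomp Require Import zify ring lra.

(* Write eta(x) = x (Krawtchouk, Hahn) or q^-x (q-Hahn). Two facts about each
   family suffice. First, by the (q-)Vandermonde summation, the expectation of a
   polynomial of degree k in eta under pi(., M, lambda) is a polynomial of degree
   at most k in eta(M); consequently the transpose of every convolution maps
   polynomials of degree at most k in eta to such polynomials. Second, P_n is
   orthogonal for pi(., N, lambda) to all polynomials of degree < n: against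
   (x - N)_j (Krawtchouk), (a + x)_j (Hahn) or (a q^x; q)_j q^(-jx) (q-Hahn), with
   j < n, the sum collapses to an n-th (q-)difference of a polynomial of degree
   less than n. Detailed balance says that K^T is self-adjoint for
   pi(., N, lambda); preserving the degree filtration as well, it has the
   orthogonal polynomials P_n as eigenvectors, whatever the parameters of the
   convolution. The rest is the completeness of an orthonormal system of N + 1
   vectors in dimension N + 1. *)

Set Implicit Arguments.
Unset Strict Implicit.
Unset Printing Implicit Defensive.

Import Order.TTheory GRing.Theory Num.Theory.

Local Open Scope ring_scope.

(** * Pochhammer symbols and moments of the three families *)

Section Pochhammer.
Variable R : realType.
Implicit Types (a b u v q : R) (k m n x M : nat).

Lemma poch0 a : poch a 0 = 1.
Proof. by rewrite /poch big_ord0. Qed.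

Lemma pochS a n : poch a n.+1 = poch a n * (a + n%:R).
Proof. by rewrite /poch big_ord_recr. Qed.

Lemma pochD a m n : poch a (m + n) = poch a m * poch (a + m%:R) n.
Proof.
elim: n => [|n IHn]; first by rewrite addn0 poch0 mulr1.
by rewrite addnS !pochS IHn natrD; ring.
Qed.

Lemma pochSl a n : poch a n.+1 = a * poch (a + 1) n.
Proof. by rewrite -add1n pochD pochS poch0 /= mul1r addr0. Qed.

Lemma poch_gt0 a n : 0 < a -> 0 < poch a n.
Proof. by move=> a0; apply: prodr_gt0 => i _; rewrite ltr_wpDr. Qed.

Lemma poch_opp_nat_eq0 M k : (M < k)%N -> poch (- M%:R : R) k = 0.
Proof.
move=> Mk; rewrite -(subnKC Mk) pochD pochS.
by rewrite addNr mulr0 mul0r.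
Qed.

Lemma poch_opp_nat_neq0 M k : (k <= M)%N -> poch (- M%:R : R) k != 0.
Proof.
elim: k => [|k IHk] kM; first by rewrite poch0 oner_eq0.
rewrite pochS mulf_neq0 ?IHk // 1?ltnW // addrC subr_eq0 eqr_nat.
by rewrite neq_ltn kM.
Qed.

Lemma qpoch0 a q : qpoch a q 0 = 1.
Proof. by rewrite /qpoch big_ord0. Qed.

Lemma qpochS a q n : qpoch a q n.+1 = qpoch a q n * (1 - a * q ^+ n).
Proof. by rewrite /qpoch big_ord_recr. Qed.

Lemma qpochD a q m n : qpoch a q (m + n) = qpoch a q m * qpoch (a * q ^+ m) q n.
Proof.
elim: n => [|n IHn]; first by rewrite addn0 qpoch0 mulr1.
by rewrite addnS !qpochS IHn exprD; ring.
Qed.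

Lemma qpochSl a q n : qpoch a q n.+1 = (1 - a) * qpoch (a * q) q n.
Proof. by rewrite -add1n qpochD qpochS qpoch0 expr0 expr1 mulr1 mul1r. Qed.

Lemma qpoch_gt0 a q n : 0 < q < 1 -> a < 1 -> 0 < qpoch a q n.
Proof.
case/andP=> q0 q1 a1; apply: prodr_gt0 => i _; rewrite subr_gt0.
have qi1 : q ^+ i <= 1 by rewrite exprn_ile1 // ltW.
have qi0 : 0 < q ^+ i by rewrite exprn_gt0.
by case: (lerP 0 a) => a0; nra.
Qed.

Lemma qpoch_inv_eq0 q M k : q != 0 -> (M < k)%N -> qpoch (q ^- M) q k = 0.
Proof.
move=> q0 Mk; rewrite -(subnKC Mk) qpochD qpochS.
by rewrite mulVf ?expf_neq0 // subrr mulr0 mul0r.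
Qed.

Lemma expr_neq1 q n : 0 < q < 1 -> 1 - q ^+ n.+1 != 0.
Proof.
by case/andP=> q0 q1; rewrite subr_eq0 eq_sym lt_eqF // exprn_ilt1 // ltW.
Qed.

Lemma qpoch_inv_neq0 q M k : 0 < q < 1 -> (k <= M)%N -> qpoch (q ^- M) q k != 0.
Proof.
move=> hq; have q0 : q != 0 by case/andP: hq => q0 _; rewrite gt_eqF.
elim: k => [|k IHk] kM; first by rewrite qpoch0 oner_eq0.
rewrite qpochS mulf_neq0 ?IHk // 1?ltnW //.
have -> : 1 - q ^- M * q ^+ k = - q ^- (M - k) * (1 - q ^+ (M - k)).
  rewrite -{1}(subnK (ltnW kM)) exprD.
  by field; rewrite !expf_neq0.
rewrite mulf_neq0 ?oppr_eq0 ?invr_eq0 ?expf_neq0 //.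
by rewrite -(subnSK kM) expr_neq1.
Qed.

(** Pascal's rule in summed form. Since [f] receives both [x] and its complement, the two terms on
    the right raise one argument each, which suits the recursions of products such as
    [poch a x * poch b y]. *)
Lemma pascal_sum (f : nat -> nat -> R) M :
  \sum_(x < M.+2) 'C(M.+1, x)%:R * f x (M.+1 - x)%N
  = \sum_(x < M.+1) 'C(M, x)%:R * (f x.+1 (M - x)%N + f x (M - x).+1).
Proof.
under [RHS]eq_bigr do rewrite mulrDr.
rewrite big_split /= big_ord_recl /= bin0.
under eq_bigr do rewrite /bump /= add1n binS natrD mulrDl subSS.
rewrite big_split /= addrA addrC; congr (_ + _).
rewrite [RHS]big_ord_recl big_ord_recr /= bin_small // mul0r addr0 bin0 !subn0.
congr (_ + _); apply: eq_bigr => i _; rewrite /bump /= add1n subnSK //.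
Qed.

Lemma binomial_mass u v M :
  \sum_(x < M.+1) 'C(M, x)%:R * (u ^+ x * v ^+ (M - x)) = (u + v) ^+ M.
Proof.
rewrite addrC exprDn; apply: eq_bigr => i _.
by rewrite mulr_natl mulrC.
Qed.

(** Chu-Vandermonde, by induction on [M]: after Pascal's rule the two new factors add up to
    [(a + x) + (b + M - x) = a + b + M], free of [x]. *)
Lemma vandermonde_mass a b M :
  \sum_(x < M.+1) 'C(M, x)%:R * (poch a x * poch b (M - x)) = poch (a + b) M.
Proof.
elim: M => [|M IHM]; first by rewrite big_ord1 !poch0 bin0 !mul1r.
rewrite (pascal_sum (fun x y => poch a x * poch b y)) pochS -IHM mulr_suml.
apply: eq_bigr => x _; rewrite !pochS.
have -> : (M%:R : R) = x%:R + (M - x)%:R by rewrite -natrD subnKC // -ltnS.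
by ring.
Qed.

(** The Gaussian binomial coefficient, in the form in which it occurs in the q-Hahn measure;
    meaningful for [x <= M]. *)
Definition qbinom q M x := qpoch q q M / (qpoch q q x * qpoch q q (M - x)).

Lemma qpochqS q n : qpoch q q n.+1 = qpoch q q n * (1 - q ^+ n.+1).
Proof. by rewrite qpochS -exprS. Qed.

Lemma qpochq_neq0 q n : 0 < q < 1 -> qpoch q q n != 0.
Proof. by move=> hq; rewrite gt_eqF // qpoch_gt0 //; case/andP: hq. Qed.

Lemma qbinomSS q M x : 0 < q < 1 -> (x <= M)%N ->
  qbinom q M.+1 x.+1 * (1 - q ^+ x.+1) = (1 - q ^+ M.+1) * qbinom q M x.
Proof.
move=> hq xM; rewrite /qbinom subSS !qpochqS.
by field; rewrite !qpochq_neq0 // expr_neq1.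
Qed.

Lemma qbinomSn q M x : 0 < q < 1 -> (x <= M)%N ->
  qbinom q M.+1 x * (1 - q ^+ (M - x).+1) = (1 - q ^+ M.+1) * qbinom q M x.
Proof.
move=> hq xM; rewrite /qbinom subSn // !qpochqS.
by field; rewrite !qpochq_neq0 // expr_neq1.
Qed.

(** Multiply by [1 - q^(M+1)] and split this factor as [(1 - q^x) + q^x (1 - q^(M+1-x))]. Each piece
    is absorbed by the q-binomial through [qbinomSS] or [qbinomSn]. *)
Lemma qpascal_sum q (f : nat -> nat -> R) M : 0 < q < 1 ->
  \sum_(x < M.+2) qbinom q M.+1 x * f x (M.+1 - x)%N
  = \sum_(x < M.+1) qbinom q M x * (f x.+1 (M - x)%N + q ^+ x * f x (M - x).+1).
Proof.
move=> hq; have qM := expr_neq1 M hq.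
apply: (mulfI qM); rewrite !mulr_sumr.
have split1 (x : 'I_M.+2) : (1 - q ^+ M.+1) * (qbinom q M.+1 x * f x (M.+1 - x)%N)
   = qbinom q M.+1 x * (1 - q ^+ x) * f x (M.+1 - x)%N +
     qbinom q M.+1 x * (1 - q ^+ (M.+1 - x)) * (q ^+ x * f x (M.+1 - x)%N).
  have xM : (x <= M.+1)%N by rewrite -ltnS.
  by rewrite -{1}(subnKC xM) exprD; ring.
under eq_bigr do rewrite split1.
rewrite big_split /=.
rewrite big_ord_recl /= expr0 subrr mulr0 mul0r add0r.
rewrite [X in _ + X]big_ord_recr /= subnn expr0 subrr mulr0 mul0r addr0.
rewrite -big_split /=; apply: eq_bigr => x _.
have xM : (x <= M)%N by rewrite -ltnS.
by rewrite /bump /= add1n subSS qbinomSS // subSn // qbinomSn //; ring.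
Qed.

(** After the q-Pascal rule the new factors combine to [(1 - a q^x) + q^x a (1 - b q^(M-x)) = 1 - a
    b q^M]. *)
Lemma qvandermonde_mass a b q M : 0 < q < 1 ->
  \sum_(x < M.+1) qbinom q M x * (qpoch a q x * qpoch b q (M - x) * a ^+ (M - x))
  = qpoch (a * b) q M.
Proof.
move=> hq; elim: M => [|M IHM].
  by rewrite big_ord1 /qbinom !qpoch0 expr0; field.
rewrite (qpascal_sum (fun x y => qpoch a q x * qpoch b q y * a ^+ y)) //.
rewrite qpochS -IHM mulr_suml.
apply: eq_bigr => x _; rewrite !qpochS exprS.
have xM : (x <= M)%N by rewrite -ltnS.
by rewrite -[in q ^+ M](subnKC xM) exprD; ring.
Qed.

Lemma opp_nat_succ n : - n.+1%:R + 1 = - n%:R :> R.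
Proof. by rewrite -natr1; ring. Qed.

(** The absorption [(x+1) C(M+1, x+1) = (M+1) C(M, x)] lowers [M] and [k] together. For [k > M] the
    truncated exponent is harmless, as [poch (- M) k] vanishes. *)
Lemma binomial_moment u v M k :
  \sum_(x < M.+1) 'C(M, x)%:R * (u ^+ x * v ^+ (M - x)) * poch (- x%:R) k
  = u ^+ k * poch (- M%:R) k * (u + v) ^+ (M - k).
Proof.
elim: k M => [|k IHk] M.
  rewrite subn0 poch0 expr0 !mul1r -binomial_mass.
  by apply: eq_bigr => x _; rewrite poch0 mulr1.
rewrite big_ord_recl /= oppr0 pochSl mul0r mulr0 add0r.
case: M => [|M]; first by rewrite big_ord0 pochSl oppr0 mul0r mulr0 mul0r.
rewrite pochSl opp_nat_succ subSS.
transitivity (- M.+1%:R * u * (u ^+ k * poch (- M%:R) k * (u + v) ^+ (M - k))).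
  rewrite -IHk mulr_sumr; apply: eq_bigr => x _.
  rewrite /bump /= add1n subSS pochSl opp_nat_succ exprS.
  have := mul_bin_diag M.+1 x; rewrite /= => /(congr1 (fun n => n%:R : R)).
  rewrite !natrM => e.
  transitivity (- (x.+1%:R * 'C(M.+1, x.+1)%:R) * (u * u ^+ x * v ^+ (M - x)) *
     poch (- x%:R) k); first by ring.
  by rewrite -e; ring.
by rewrite exprS; ring.
Qed.

(** Same absorption; peeling the first factor off [poch a (x+1)] replaces [a] by [a + 1], so the
    induction is general in [a]. *)
Lemma vandermonde_moment a b M k :
  \sum_(x < M.+1) 'C(M, x)%:R * (poch a x * poch b (M - x)) * poch (- x%:R) k
  = poch a k * poch (- M%:R) k * poch (a + b + k%:R) (M - k).
Proof.
elim: k M a => [|k IHk] M a.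
  rewrite subn0 !poch0 addr0 !mul1r -vandermonde_mass.
  by apply: eq_bigr => x _; rewrite poch0 mulr1.
rewrite big_ord_recl /= oppr0 (pochSl 0) mul0r mulr0 add0r.
case: M => [|M]; first by rewrite big_ord0 (pochSl (- _)) oppr0 mul0r mulr0 mul0r.
rewrite (pochSl (- _)) opp_nat_succ subSS.
transitivity (- M.+1%:R * a *
    (poch (a + 1) k * poch (- M%:R) k * poch (a + 1 + b + k%:R) (M - k))).
  rewrite -IHk mulr_sumr; apply: eq_bigr => x _.
  rewrite /bump /= add1n subSS (pochSl (- _)) opp_nat_succ (pochSl a).
  have := mul_bin_diag M.+1 x; rewrite /= => /(congr1 (fun n => n%:R : R)).
  rewrite !natrM => e.
  transitivity (- (x.+1%:R * 'C(M.+1, x.+1)%:R) *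
      (a * poch (a + 1) x * poch b (M - x)) * poch (- x%:R) k); first by ring.
  by rewrite -e; ring.
rewrite (pochSl a).
have -> : a + 1 + b + k%:R = a + b + k.+1%:R by rewrite -natr1; ring.
by ring.
Qed.

(** Here [a] becomes [a q] at each step: absorption leaves a factor [q^(M-x)], exactly what turns
    the weight [a^(M-x)] into [(a q)^(M-x)]. *)
Lemma qvandermonde_moment a b q M k : 0 < q < 1 ->
  \sum_(x < M.+1) qbinom q M x * (qpoch a q x * qpoch b q (M - x) * a ^+ (M - x))
     * qpoch (q ^- x) q k
  = qpoch a q k * qpoch (q ^- M) q k * qpoch (a * b * q ^+ k) q (M - k).
Proof.
move=> hq; have q0 : q != 0 by case/andP: hq => q0 _; rewrite gt_eqF.
have invS n : q ^- n.+1 * q = q ^- n.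
  by rewrite exprSr invfM -mulrA mulVf // mulr1.
elim: k M a => [|k IHk] M a.
  rewrite subn0 !qpoch0 expr0 !mul1r mulr1 -qvandermonde_mass //.
  by apply: eq_bigr => x _; rewrite qpoch0 mulr1.
rewrite big_ord_recl /= expr0 invr1 (qpochSl 1) subrr mul0r mulr0 add0r.
case: M => [|M].
  by rewrite big_ord0 (qpochSl _^-1) expr0 invr1 subrr mul0r mulr0 mul0r.
rewrite (qpochSl (q ^- _)) invS subSS.
transitivity ((1 - q ^- M.+1) * (1 - a) * (qpoch (a * q) q k * qpoch (q ^- M) q k *
   qpoch (a * q * b * q ^+ k) q (M - k))).
  rewrite -IHk mulr_sumr; apply: eq_bigr => x _.
  rewrite /bump /= add1n subSS (qpochSl (q ^- _)) invS (qpochSl a) exprMn.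
  have xM : (x <= M)%N by rewrite -ltnS.
  have e : qbinom q M.+1 x.+1 * (1 - q ^- x.+1)
           = (1 - q ^- M.+1) * q ^+ (M - x) * qbinom q M x.
    have -> : 1 - q ^- x.+1 = - q ^- x.+1 * (1 - q ^+ x.+1).
      by rewrite mulrBr mulr1 mulNr mulVf ?expf_neq0 //; ring.
    have eM : q ^+ M.+1 = q ^+ (M - x) * q ^+ x.+1.
      by rewrite -exprD addnS subnK.
    rewrite mulrCA qbinomSS // eM.
    by field; rewrite !expf_neq0.
  rewrite [X in X = _](_ : _ = qbinom q M.+1 x.+1 * (1 - q ^- x.+1) *
     ((1 - a) * qpoch (a * q) q x * qpoch b q (M - x) * a ^+ (M - x)
      * qpoch (q ^- x) q k)); last by ring.
  by rewrite e; ring.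
rewrite (qpochSl a) (exprS _ k).
have -> : a * q * b * q ^+ k = a * b * (q * q ^+ k) by ring.
by ring.
Qed.

End Pochhammer.

(** * Kernels preserving the degree *)

Section GradedKernels.
Variables (R : realType) (eta : nat -> R) (N : nat).
Implicit Types (f g : nat -> R) (w : nat -> nat -> R) (p : {poly R}).

(** One polynomial of each exact degree gives a triangular basis: a multiple of [S n] removes the
    top coefficient, and induction does the rest. *)
Lemma poly_span (S : nat -> {poly R}) n p :
  (forall j, size (S j) = j.+1) -> (size p <= n)%N ->
  exists c : nat -> R, p = \sum_(j < n) c j *: S j.
Proof.
move=> sS; elim: n p => [|n IHn] p sp.
  exists (fun=> 0); rewrite big_ord0; apply/eqP.
  by rewrite -size_poly_leq0.
have lS : (S n)`_n != 0.
  by have := lead_coef_eq0 (S n); rewrite lead_coefE sS /= -size_poly_eq0 sS => ->.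
have [] := IHn (p - (p`_n / (S n)`_n) *: S n).
  apply/leq_sizeP => j; rewrite leq_eqVlt => /predU1P[<-|nj].
    by rewrite coefB coefZ divfK // subrr.
  rewrite coefB coefZ (nth_default _ (leq_trans sp nj)) sub0r.
  by rewrite (@nth_default _ _ (S n) j) ?sS // mulr0 oppr0.
move=> c /eqP; rewrite subr_eq => /eqP ->.
exists (fun j => if (j < n)%N then c j else p`_n / (S n)`_n).
rewrite big_ord_recr /= ltnn; congr (_ + _).
by apply: eq_bigr => i _; rewrite ltn_ord.
Qed.

(** Degree at most [n] in [eta], with agreement required only at the points [0..N], where the
    kernels live. *)
Definition poly_in n f :=
  exists2 p : {poly R}, (size p <= n.+1)%N
    & forall y, (y <= N)%N -> f y = p.[eta y].

Lemma poly_in_ext n f g :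
  (forall y, (y <= N)%N -> f y = g y) -> poly_in n f -> poly_in n g.
Proof.
by move=> fg [p sp fp]; exists p => // y yN; rewrite -fg // fp.
Qed.

Lemma poly_in_le m n f : (m <= n)%N -> poly_in m f -> poly_in n f.
Proof. by move=> mn [p sp fp]; exists p => //; apply: leq_trans sp _. Qed.

Lemma poly_in_sum n (I : Type) (r : seq I) (F : I -> nat -> R) :
  (forall i, poly_in n (F i)) -> poly_in n (fun y => \sum_(i <- r) F i y).
Proof.
move=> hF; elim: r => [|i r [p sp hp]].
  by exists 0; rewrite ?size_poly0 // => y _; rewrite big_nil horner0.
have [q sq hq] := hF i; exists (q + p) => [|y yN].
  by apply: leq_trans (size_polyD _ _) _; rewrite geq_max sq.
by rewrite big_cons hornerD hq // hp.
Qed.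

Lemma poly_inM m n f g :
  poly_in m f -> poly_in n g -> poly_in (m + n) (fun y => f y * g y).
Proof.
move=> [p sp fp] [r sr gr]; exists (p * r) => [|y yN].
  by apply: leq_trans (size_polyMleq _ _) _; lia.
by rewrite hornerM fp // gr.
Qed.

Lemma poly_inZ n c f : poly_in n f -> poly_in n (fun y => c * f y).
Proof.
move=> [p sp fp]; exists (c *: p) => [|y yN].
  exact: leq_trans (size_scale_leq _ _) sp.
by rewrite hornerZ fp.
Qed.

(** The sum runs over the first index: columns are the laws, so this is the action of the transpose.
    Testing powers of [eta] is enough by linearity. *)
Definition graded w :=
  forall k, poly_in k (fun y => \sum_(z < N.+1) w z y * eta z ^+ k).

Lemma graded_apply w n f :
  graded w -> poly_in n f -> poly_in n (fun y => \sum_(z < N.+1) w z y * f z).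
Proof.
move=> gw [p sp fp].
apply: (@poly_in_ext _
  (fun y => \sum_(k < size p) p`_k * \sum_(z < N.+1) w z y * eta z ^+ k)).
  move=> y yN; under eq_bigr do rewrite mulr_sumr.
  rewrite exchange_big; apply: eq_bigr => z _ /=.
  rewrite fp -1?ltnS // horner_coef mulr_sumr.
  by apply: eq_bigr => k _; rewrite mulrCA.
apply: poly_in_sum => k; apply: poly_inZ; apply: (@poly_in_le k) => //.
by rewrite -ltnS (leq_trans (ltn_ord k)).
Qed.

(** A semantic substitute for total degree at most [k] in [eta z2] and [eta z1]: averaging over two
    independent graded kernels started at the same [y] leaves degree at most [k] in [eta y].
    Bivariate polynomials are thereby avoided. *)
Definition bigraded k (F : nat -> nat -> R) :=
  forall w1 w2, graded w1 -> graded w2 ->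
    poly_in k (fun y => \sum_(z2 < N.+1) \sum_(z1 < N.+1)
                         w1 z2 y * w2 z1 y * F z2 z1).

Lemma bigraded_mono i j k : (i + j <= k)%N ->
  bigraded k (fun z2 z1 => eta z2 ^+ i * eta z1 ^+ j).
Proof.
move=> ijk w1 w2 gw1 gw2.
apply: poly_in_le ijk (poly_in_ext _ (poly_inM (gw1 i) (gw2 j))) => y yN.
rewrite mulr_suml; apply: eq_bigr => z2 _; rewrite mulr_sumr.
by apply: eq_bigr => z1 _; ring.
Qed.

Lemma bigraded_sum k (I : Type) (r : seq I) (F : I -> nat -> nat -> R) :
  (forall i, bigraded k (F i)) ->
  bigraded k (fun z2 z1 => \sum_(i <- r) F i z2 z1).
Proof.
move=> hF w1 w2 gw1 gw2.
apply: poly_in_ext (poly_in_sum r (fun i => hF i _ _ gw1 gw2)) => y yN.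
rewrite exchange_big; apply: eq_bigr => z2 _ /=.
rewrite exchange_big; apply: eq_bigr => z1 _ /=.
by rewrite mulr_sumr.
Qed.

Lemma bigradedZ k c F : bigraded k F -> bigraded k (fun z2 z1 => c * F z2 z1).
Proof.
move=> hF w1 w2 gw1 gw2.
apply: poly_in_ext (poly_inZ c (hF _ _ gw1 gw2)) => y yN.
rewrite mulr_sumr; apply: eq_bigr => z2 _ /=.
by rewrite mulr_sumr; apply: eq_bigr => z1 _ /=; ring.
Qed.

End GradedKernels.

(** * Moments of the measures as polynomials in the grid variable *)

Section Moments.
Variables (R : realType) (q : R).
Hypothesis hq : 0 < q < 1.

Let q0 : q != 0. Proof. by case/andP: hq => q0 _; rewrite gt_eqF. Qed.

Definition grid (F : ortho_family) (x : nat) : R :=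
  match F with QHahn => q ^- x | _ => x%:R end.

(** The factor [(-x)_k], or [(q^-x; q)_k], of the hypergeometric sums, as a polynomial of exact
    degree [k] in the grid variable. *)
Definition poch_poly (F : ortho_family) (k : nat) : {poly R} :=
  match F with
  | QHahn => \prod_(i < k) (1 - q ^+ i *: 'X)
  | _ => \prod_(i < k) (i%:R%:P - 'X)
  end.

Lemma size_poch_poly F k : size (poch_poly F k) = k.+1.
Proof.
have lin (G : nat -> {poly R}) : (forall i, size (G i) = 2%N) ->
    size (\prod_(i < k) G i) = k.+1.
  move=> sG; rewrite size_prod => [|i _]; last by rewrite -size_poly_eq0 sG.
  rewrite (eq_bigr (fun=> 2%N)) // sum_nat_const card_ord; lia.
have linX i : size (i%:R%:P - 'X : {poly R}) = 2%N.
  by rewrite -opprB size_polyN size_XsubC.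
case: F; [exact: (lin (fun i => i%:R%:P - 'X))..|].
apply: (lin (fun i => 1 - q ^+ i *: 'X)) => i.
have qi : q ^+ i != 0 by rewrite expf_neq0.
by rewrite addrC size_polyDl size_polyN size_scale ?size_polyX // size_poly1.
Qed.

Lemma horner_poch_poly F k x :
  (poch_poly F k).[grid F x] =
  if F is QHahn then qpoch (q ^- x) q k else poch (- x%:R) k.
Proof.
case: F; rewrite /= horner_prod; apply: eq_bigr => i _; rewrite ?hornerE.
- by rewrite addrC.
- by rewrite addrC.
by rewrite mulrC.
Qed.

(** The constant does not depend on [M]: in the basis [poch_poly] the expectation acts diagonally,
    with entries [p^k], [(a)_k / (a+b)_k] and [(a;q)_k / (ab;q)_k]. *)
Lemma pi_poch_moment F (l : fparam R F) k : admissible l ->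
  exists c, forall M, \sum_(x < M.+1) pi_meas q x M l * (poch_poly F k).[grid F x]
    = c * (poch_poly F k).[grid F M].
Proof.
move=> hl.
(* When [M < k], all grid points up to [M] are roots of [poch_poly F k] and both sides are zero. *)
suff [c hc] : exists c, forall M, (k <= M)%N ->
   \sum_(x < M.+1) pi_meas q x M l * (poch_poly F k).[grid F x]
    = c * (poch_poly F k).[grid F M].
  exists c => M; have [/hc//|Mk] := leqP k M.
  have z x : (x <= M)%N -> (poch_poly F k).[grid F x] = 0.
    move=> xM; have xk := leq_ltn_trans xM Mk; rewrite horner_poch_poly.
    by case: (F); rewrite ?poch_opp_nat_eq0 ?qpoch_inv_eq0.
  rewrite z // mulr0 big1 // => x _.
  by rewrite z ?mulr0 // -ltnS.
have guard (T : Type) (x M : nat) (a b : T) :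
  (x < M.+1)%N -> (if (x <= M)%N then a else b) = a.
  by rewrite ltnS => ->.
case: F l hl => [p|[a b]|[a b]] /= hl.
- exists (p ^+ k) => M kM; rewrite !(horner_poch_poly Krawtchouk).
  under eq_bigr do rewrite guard // (horner_poch_poly Krawtchouk) -(mulrA _ (p ^+ _)).
  by rewrite binomial_moment addrC subrK expr1n mulr1.
- case: hl => a0 b0; exists (poch a k / poch (a + b) k) => M kM.
  rewrite !(horner_poch_poly Hahn).
  under eq_bigr do rewrite guard // (horner_poch_poly Hahn) mulrA mulrAC.
  have eM : poch (a + b) M = poch (a + b) k * poch (a + b + k%:R) (M - k).
    by rewrite -pochD subnKC.
  rewrite -mulr_suml vandermonde_moment eM.
  have c1 : poch (a + b) k != 0 by rewrite gt_eqF // poch_gt0 // addr_gt0.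
  have c2 : poch (a + b + k%:R) (M - k) != 0.
    by rewrite gt_eqF // poch_gt0 // ltr_wpDr // addr_gt0.
  by field; rewrite c1 c2.
case: hl => /andP[a0 a1] b1; exists (qpoch a q k / qpoch (a * b) q k) => M kM.
have ab1 : a * b < 1 by nra.
rewrite !(horner_poch_poly QHahn).
under eq_bigr do rewrite guard // (horner_poch_poly QHahn) mulrA mulrAC.
have eM : qpoch (a * b) q M
    = qpoch (a * b) q k * qpoch (a * b * q ^+ k) q (M - k).
  by rewrite -qpochD subnKC.
(* Positivity of the whole product, which follows from [a b < 1] even for negative [b], shows that
   both of its pieces are nonzero. *)
have := lt0r_neq0 (qpoch_gt0 M hq ab1).
rewrite -mulr_suml qvandermonde_moment // eM mulf_eq0 negb_or => /andP[c1 c2].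
by field; rewrite c1 c2.
Qed.

Lemma pi_moment F (l : fparam R F) (p : {poly R}) : admissible l ->
  exists2 r : {poly R}, (size r <= size p)%N & forall M,
    \sum_(x < M.+1) pi_meas q x M l * p.[grid F x] = r.[grid F M].
Proof.
move=> hl; have [c def_p] := poly_span (size_poch_poly F) (leqnn (size p)).
have /choice[d hd] : forall k, exists d, forall M,
    \sum_(x < M.+1) pi_meas q x M l * (poch_poly F k).[grid F x]
    = d * (poch_poly F k).[grid F M].
  by move=> k; apply: pi_poch_moment.
exists (\sum_(j < size p) (c j * d j) *: poch_poly F j) => [|M].
  apply: leq_trans (size_sum _ _ _) _; apply/bigmax_leqP => j _.
  by rewrite (leq_trans (size_scale_leq _ _)) // size_poch_poly.
rewrite {1}def_p; under eq_bigr do rewrite horner_sum mulr_sumr.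
rewrite exchange_big horner_sum; apply: eq_bigr => j _ /=.
rewrite hornerZ -mulrA -hd mulr_sumr.
by apply: eq_bigr => x _; rewrite hornerZ mulrCA.
Qed.

End Moments.

(** * Changing the ranges of sums *)

Section SumRanges.
Variable R : realType.
Implicit Types (f : nat -> R).

(** For [b < a] the left side is empty, and the hypothesis then covers every index, so the right
    side is zero too. *)
Lemma sum_nat_extend f a b n : (b <= n)%N ->
  (forall z, (z < n)%N -> (z < a)%N || (b <= z)%N -> f z = 0) ->
  \sum_(a <= z < b) f z = \sum_(z < n) f z.
Proof.
move=> bn f0; rewrite -(big_mkord xpredT) /=.
have zero m p : (forall z, (m <= z < p)%N -> f z = 0) -> \sum_(m <= z < p) f z = 0.
  by move=> fz; rewrite big1_seq // => z; rewrite mem_index_iota => /fz.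
have [ab|ba] := leqP a b.
  rewrite [RHS](big_cat_nat (n := a)) ?(leq_trans ab) //=.
  rewrite (zero 0) ?add0r => [|z za]; last by apply: f0; lia.
  rewrite [RHS](big_cat_nat (n := b)) //= [X in _ = _ + X]zero ?addr0 // => z bz.
  by apply: f0; lia.
by rewrite big_geq ?(ltnW ba) // zero // => z zn; apply: f0; lia.
Qed.

Lemma sum_ord_extend f m n : (m <= n)%N ->
  (forall z, (z < n)%N -> (m <= z)%N -> f z = 0) ->
  \sum_(z < n) f z = \sum_(z < m) f z.
Proof.
move=> mn f0; rewrite -[RHS](big_mkord xpredT) (sum_nat_extend mn) //.
Qed.

Lemma sum_ord_shift f a n : (a <= n)%N ->
  \sum_(x < n.+1) (if (a <= x)%N then f x else 0)
  = \sum_(u < (n - a).+1) f (a + u)%N.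
Proof.
move=> an; rewrite -(@sum_nat_extend (fun x => if (a <= x)%N then f x else 0) a n.+1) //;
  last first.
  by move=> z zn; rewrite (leqNgt n.+1) zn orbF ltnNge => /negbTE ->.
rewrite -{1}[a]add0n big_addn -subSn // big_mkord.
by apply: eq_bigr => u _ /=; rewrite leq_addl addnC.
Qed.

End SumRanges.

(** * Graded kernels built from the measures *)

Section Kernels.
Variables (R : realType) (q : R) (N : nat) (F : ortho_family).
Hypothesis hq : 0 < q < 1.
Local Notation eta := (grid q F).
Local Notation graded := (graded eta N).
Local Notation bigraded := (bigraded eta N).
Implicit Types (l : fparam R F) (w : nat -> nat -> R).

Let q0 : q != 0. Proof. by case/andP: hq => q0 _; rewrite gt_eqF. Qed.

Lemma pi_meas_out x M l : (M < x)%N -> pi_meas q x M l = 0.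
Proof.
by rewrite ltnNge => /negbTE xM; case: F l => [p|[a b]|[a b]] /=; rewrite xM.
Qed.

Lemma pi_meas_sum (f : nat -> R) M n l : (M <= n)%N ->
  \sum_(x < n.+1) pi_meas q x M l * f x = \sum_(x < M.+1) pi_meas q x M l * f x.
Proof.
move=> Mn; apply: (@sum_ord_extend _ (fun x => pi_meas q x M l * f x)) => //.
by move=> z _ Mz; rewrite pi_meas_out // mul0r.
Qed.

Lemma pi_power_moment l k : admissible l ->
  exists2 r : {poly R}, (size r <= k.+1)%N & forall M,
    \sum_(x < M.+1) pi_meas q x M l * eta x ^+ k = r.[eta M].
Proof.
move=> hl; have [r sr hr] := pi_moment hq 'X^k hl.
exists r => [|M]; first by rewrite size_polyXn in sr.
by rewrite -hr; apply: eq_bigr => x _; rewrite hornerXn.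
Qed.

(* For the q-grid, eta(z1 - z2) = eta z1 / eta z2; the factor eta z2 ^+ k makes
   the powers nonnegative. *)
Lemma pi_bridge_moment l k : admissible l ->
  exists2 G, bigraded k G & forall z2 z1, (z2 <= z1)%N ->
    \sum_(u < (z1 - z2).+1) pi_meas q u (z1 - z2) l * eta (z2 + u)%N ^+ k
    = G z2 z1.
Proof.
move=> hl.
have /choice[r hr] : forall j, exists r : {poly R}, (size r <= j.+1)%N /\ forall M,
    \sum_(x < M.+1) pi_meas q x M l * eta x ^+ j = r.[eta M].
  by move=> j; have [r sr er] := pi_power_moment j hl; exists r.
have sr j : (size (r j) <= j.+1)%N by case: (hr j).
have er j := (hr j).2.
have linear : (forall n, eta n = n%:R) -> exists2 G, bigraded k G &
    forall z2 z1, (z2 <= z1)%N ->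
    \sum_(u < (z1 - z2).+1) pi_meas q u (z1 - z2) l * eta (z2 + u)%N ^+ k
    = G z2 z1.
  (* Linear grid: expand [(z2 + u)^k] by the binomial theorem, replace the [j]-th moment of [u] by a
     polynomial of degree at most [j] in [z1 - z2], and expand again. Every monomial has total
     degree at most [k]. *)
  move=> etaE; exists (fun z2 z1 => \sum_(j < k.+1) 'C(k, j)%:R *
     \sum_(m < size (r j)) (r j)`_m * (\sum_(i < m.+1) ('C(m, i)%:R * (-1) ^+ i) *
       (eta z2 ^+ (k - j + i) * eta z1 ^+ (m - i)))).
    apply: bigraded_sum => j; apply: bigradedZ; apply: bigraded_sum => m.
    apply: bigradedZ; apply: bigraded_sum => i; apply: bigradedZ.
    apply: bigraded_mono; have := leq_trans (ltn_ord m) (sr j).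
    by have := ltn_ord i; have := ltn_ord j; lia.
  move=> z2 z1 z21.
  transitivity (\sum_(j < k.+1) 'C(k, j)%:R * (eta z2 ^+ (k - j) *
    \sum_(u < (z1 - z2).+1) pi_meas q u (z1 - z2) l * eta u ^+ j)).
    under [RHS]eq_bigr do rewrite mulr_sumr mulr_sumr.
    rewrite exchange_big; apply: eq_bigr => u _ /=.
    rewrite !etaE natrD exprDn mulr_sumr; apply: eq_bigr => j _.
    by rewrite -mulr_natl; ring.
  apply: eq_bigr => j _; congr (_ * _); rewrite er horner_coef mulr_sumr.
  apply: eq_bigr => m _; rewrite mulrCA; congr (_ * _).
  rewrite !etaE natrB // exprDn mulr_sumr; apply: eq_bigr => i _.
  by rewrite (exprNn z2%:R) -(mulr_natl (_ * _)) exprD; ring.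
case: F l hl r hr sr er linear => [p|ab|ab] hl r hr sr er linear.
- exact: linear.
- exact: linear.
exists (fun z2 z1 => \sum_(m < size (r k)) (r k)`_m *
    (q ^- z2 ^+ (k - m) * q ^- z1 ^+ m)) => [|z2 z1 z21].
  apply: bigraded_sum => m; apply: bigradedZ.
  apply: (bigraded_mono (eta := grid q QHahn)).
  by have := leq_trans (ltn_ord m) (sr k); lia.
transitivity (q ^- z2 ^+ k * \sum_(u < (z1 - z2).+1)
    pi_meas q u (z1 - z2) (ab : fparam R QHahn) * grid q QHahn u ^+ k).
  rewrite mulr_sumr; apply: eq_bigr => u _.
  rewrite [grid _ _ _]/= [grid _ _ u]/= exprD invfM exprMn; ring.
rewrite er horner_coef mulr_sumr; apply: eq_bigr => m _; rewrite mulrCA /=.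
congr (_ * _); have mk : (m <= k)%N by rewrite -ltnS (leq_trans (ltn_ord m)).
have e : q ^- z1 = q ^- z2 * q ^- (z1 - z2) by rewrite -invfM -exprD subnKC.
by rewrite e exprMn mulrA -exprD subnK.
Qed.

Lemma graded_comp w w' : graded w -> graded w' ->
  graded (fun u y => \sum_(v < N.+1) w u v * w' v y).
Proof.
move=> gw gw' k; apply: poly_in_ext (graded_apply gw' (gw k)) => y yN.
under [RHS]eq_bigr do rewrite mulr_suml.
rewrite exchange_big; apply: eq_bigr => v _ /=; rewrite mulr_sumr.
by apply: eq_bigr => u _; ring.
Qed.

Lemma graded_id : graded (fun z y => (z == y)%:R).
Proof.
move=> k; exists 'X^k => [|y yN]; first by rewrite size_polyXn.
rewrite hornerXn (bigD1 (Ordinal (yN : (y < N.+1)%N))) //= eqxx mul1r.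
by rewrite big1 ?addr0 // => z; rewrite -val_eqE /= => /negbTE ->; rewrite mul0r.
Qed.

(** The degenerate kernel that pins an endpoint, used with [c = 0] and [c = N]. *)
Lemma graded_const c : (c <= N)%N -> graded (fun z _ => (z == c)%:R).
Proof.
move=> cN k; exists (eta c ^+ k)%:P => [|y yN].
  by rewrite (leq_trans (size_polyC_leq1 _)).
rewrite hornerC (bigD1 (Ordinal (cN : (c < N.+1)%N))) //= eqxx mul1r.
by rewrite big1 ?addr0 // => z; rewrite -val_eqE /= => /negbTE ->; rewrite mul0r.
Qed.

Lemma graded_pi l : admissible l -> graded (fun z y => pi_meas q z y l).
Proof.
move=> hl k; have [r sr hr] := pi_power_moment k hl; exists r => // y yN.
by rewrite -hr (pi_meas_sum (fun x => eta x ^+ k)).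
Qed.

(** The measure transported to the interval from [y] to [z']. For [z' < y] the truncated length is
    meaningless, and such values only occur with weight zero. *)
Definition pi_shift l z y z' : R :=
  if (y <= z)%N then pi_meas q (z - y) (z' - y) l else 0.

Lemma pi_shift_sum l (f : nat -> R) z2 z1 : (z2 <= z1)%N -> (z1 <= N)%N ->
  \sum_(x < N.+1) pi_shift l x z2 z1 * f x
  = \sum_(u < (z1 - z2).+1) pi_meas q u (z1 - z2) l * f (z2 + u)%N.
Proof.
move=> z21 z1N.
rewrite -(pi_meas_sum (fun u => f (z2 + u)%N) l (leq_sub2r z2 z1N)).
have z2N := leq_trans z21 z1N.
rewrite [RHS](eq_bigr (fun u : 'I_(N - z2).+1 =>
  pi_meas q (z2 + u - z2) (z1 - z2) l * f (z2 + u)%N)); last first.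
  by move=> u _; rewrite addKn.
rewrite -(sum_ord_shift (fun x => pi_meas q (x - z2) (z1 - z2) l * f x)) //.
by apply: eq_bigr => x _; rewrite /pi_shift; case: ifP => // _; rewrite mul0r.
Qed.

(** The bridge with lower end [y] (identity kernel) and upper end pinned at [N]. *)
Lemma graded_pi_shift l : admissible l -> graded (fun z y => pi_shift l z y N).
Proof.
move=> hl k; have [G bG eG] := pi_bridge_moment k hl.
apply: poly_in_ext (bG _ _ graded_id (graded_const (leqnn N))) => y yN.
rewrite (pi_shift_sum l (fun x => eta x ^+ k)) // eG //.
rewrite (bigD1 (Ordinal (yN : (y < N.+1)%N))) //=.
rewrite [X in _ + X]big1 ?addr0 => [|z]; last first.
  rewrite -val_eqE /= => /negbTE ->; rewrite big1 // => z1 _.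
  by rewrite !mul0r.
rewrite (bigD1 ord_max) //= !eqxx !mul1r big1 ?addr0 // => z.
by rewrite -val_eqE /= => /negbTE ->; rewrite mulr0 mul0r.
Qed.

(** Given [y], draw [z2] and [z1] independently, then redistribute on the interval between them. The
    support conditions force [z2 <= y <= z1], where the moment formula of the bridge is valid. *)
Lemma graded_bridge w1 w2 l : admissible l -> graded w1 -> graded w2 ->
  (forall z y, (y < z)%N -> w1 z y = 0) ->
  (forall z y, (y <= N)%N -> (z < y)%N -> w2 z y = 0) ->
  graded (fun x y => \sum_(z2 < N.+1) \sum_(z1 < N.+1)
                       w1 z2 y * w2 z1 y * pi_shift l x z2 z1).
Proof.
move=> hl gw1 gw2 s1 s2 k; have [G bG eG] := pi_bridge_moment k hl.
apply: poly_in_ext (bG _ _ gw1 gw2) => y yN.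
under [RHS]eq_bigr do rewrite mulr_suml.
rewrite [RHS]exchange_big; apply: eq_bigr => z2 _ /=.
under [RHS]eq_bigr do rewrite mulr_suml.
rewrite [RHS]exchange_big; apply: eq_bigr => z1 _ /=.
have [z21|/s1 ->] := leqP z2 y; last first.
  by rewrite !mul0r big1 // => x _; rewrite !mul0r.
have [yz1|/(s2 _ _ yN) ->] := leqP y z1; last first.
  by rewrite mulr0 mul0r big1 // => x _; rewrite !mul0r.
rewrite -eG ?(leq_trans z21) //.
rewrite -(pi_shift_sum l (fun x => eta x ^+ k)) ?(leq_trans z21) //; last first.
  by rewrite -ltnS.
by rewrite mulr_sumr; apply: eq_bigr => x _; rewrite mulrA.
Qed.

(** * Reflection and addition on the linear grid *)

Section Linear.
Hypothesis etaE : forall n, eta n = n%:R.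

(** On a linear grid [N - y] is affine in [y], so the substitution keeps the degree; on the q-grid
    it would invert [eta] up to a factor. *)
Lemma graded_reflect w : graded w -> graded (fun z y => w z (N - y)%N).
Proof.
move=> gw k; have [p sp hp] := gw k.
exists (p \Po (N%:R%:P - 'X)) => [|y yN].
  by rewrite size_comp_poly2 // -opprB size_polyN size_XsubC.
by rewrite horner_comp !hornerE hp ?leq_subr // !etaE natrB.
Qed.

(** The law of a sum of two independent draws [z] and [u]; its moments follow by expanding
    [(z + u)^k]. The supports [z <= y] and [u <= N - y] keep the sum within [N], so cutting the
    range of [x] loses nothing. *)
Lemma graded_add w1 w2 : graded w1 -> graded w2 ->
  (forall z y, (y < z)%N -> w1 z y = 0) ->
  (forall u y, (y <= N)%N -> (N - y < u)%N -> w2 u y = 0) ->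
  graded (fun x y => \sum_(z < N.+1)
                       w1 z y * (if (z <= x)%N then w2 (x - z)%N y else 0)).
Proof.
move=> gw1 gw2 s1 s2 k.
have bG : bigraded k (fun z2 z1 => \sum_(j < k.+1) 'C(k, j)%:R *
    (eta z2 ^+ (k - j) * eta z1 ^+ j)).
  apply: bigraded_sum => j; apply: bigradedZ; apply: bigraded_mono.
  by have := ltn_ord j; lia.
apply: poly_in_ext (bG _ _ gw1 gw2) => y yN.
under [RHS]eq_bigr do rewrite mulr_suml.
rewrite [RHS]exchange_big; apply: eq_bigr => z _ /=.
have zN : (z <= N)%N by rewrite -ltnS.
have [zy|/s1 ->] := leqP z y; last first.
  by rewrite !big1 // => x _; rewrite !mul0r.
transitivity (\sum_(u < N.+1) w2 u y * (w1 z y * (z + u)%:R ^+ k)).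
  apply: eq_bigr => u _; rewrite natrD exprDn.
  rewrite [RHS]mulrA [w2 _ _ * _]mulrC; congr (_ * _).
  by apply: eq_bigr => j _; rewrite !etaE mulr_natl.
rewrite (@sum_ord_extend _ (fun u => w2 u y * (w1 z y * (z + u)%:R ^+ k)) (N - z).+1);
  [|lia|]; last by move=> u uN zu; rewrite s2 ?mul0r //; lia.
rewrite [LHS](eq_bigr (fun u : 'I_(N - z).+1 =>
  w2 (z + u - z)%N y * (w1 z y * (z + u)%:R ^+ k))); last first.
  by move=> u _; rewrite addKn.
rewrite -(sum_ord_shift (fun x => w2 (x - z)%N y * (w1 z y * x%:R ^+ k))) //.
by apply: eq_bigr => x _; rewrite etaE; case: ifP => _; ring.
Qed.

End Linear.

End Kernels.

(** * The convolutions *)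

Lemma sum_nat_ord (R : realType) (g f : nat -> R) a b n : (b <= n)%N ->
  (forall z, (a <= z < b)%N -> f z = g z) ->
  (forall z, (z < n)%N -> (z < a)%N || (b <= z)%N -> g z = 0) ->
  \sum_(a <= z < b) f z = \sum_(z < n) g z.
Proof.
by move=> bn fg g0; rewrite (eq_big_nat _ _ fg) (sum_nat_extend bn).
Qed.

Lemma sum_ord_delta (R : realType) (f : nat -> R) c n : (c < n)%N ->
  \sum_(z < n) (val z == c)%:R * f z = f c.
Proof.
move=> cn; rewrite (bigD1 (Ordinal cn)) //= eqxx mul1r big1 ?addr0 // => z.
by rewrite -val_eqE /= => /negbTE ->; rewrite mul0r.
Qed.

Section Generated.
Variables (R : realType) (q : R) (N : nat) (F : ortho_family).
Hypothesis hq : 0 < q < 1.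
Local Notation graded := (graded (grid q F) N).
Implicit Types (l : fparam R F).

Lemma grid_linear : F <> QHahn -> forall n, grid q F n = n%:R.
Proof. by case: F. Qed.

(** A bridge with random ends [z2 <= y <= z1]; the bounds in the convolution are those outside which
    some factor vanishes. *)
Lemma conv4_graded l1 l2 l3 : admissible l1 -> admissible l2 -> admissible l3 ->
  exists2 w, graded w & forall x y, conv4 q N l1 l2 l3 x y = w x y.
Proof.
move=> h1 h2 h3; exists (fun x y => \sum_(z2 < N.+1) \sum_(z1 < N.+1)
    pi_meas q z2 y l1 * pi_shift q l2 z1 y N * pi_shift q l3 x z2 z1).
  apply: (graded_bridge hq h3 (graded_pi N hq h1) (graded_pi_shift N hq h2)).
    by move=> z y yz; rewrite pi_meas_out.
  by move=> z y _ zy; rewrite /pi_shift leqNgt zy.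
move=> x y; rewrite mxE; have xN := ltn_ord x; have yN := ltn_ord y.
apply: (sum_nat_ord (g := fun z2 => \sum_(z1 < N.+1) pi_meas q z2 y l1 *
    pi_shift q l2 z1 y N * pi_shift q l3 x z2 z1)) => [|z2 z2min|z2 z2N hz2].
- lia.
- under [RHS]eq_bigr do rewrite -mulrA.
  rewrite -mulr_sumr; congr (_ * _).
  apply: (sum_nat_ord (g := fun z1 => pi_shift q l2 z1 y N *
    pi_shift q l3 x z2 z1)) => // z1 z1max.
    by rewrite /pi_shift !ifT 1?[LHS]mulrC //; lia.
  move=> hz1; rewrite /pi_shift; case: leqP => yz1; last by rewrite mul0r.
  by rewrite (@pi_meas_out _ _ _ (x - z2)%N) ?if_same ?mulr0 //; lia.
rewrite big1 // => z1 _.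
have [yz2|z2y] := ltnP y z2; first by rewrite pi_meas_out // !mul0r.
by rewrite /pi_shift (@ifF _ (z2 <= x)%N) ?mulr0 //; lia.
Qed.

(** A bridge whose upper end is pinned at [N]. *)
Lemma conv1_graded l1 l2 : admissible l1 -> admissible l2 ->
  exists2 w, graded w & forall x y, conv1 q N l1 l2 x y = w x y.
Proof.
move=> h1 h2; exists (fun x y => \sum_(z2 < N.+1) \sum_(z1 < N.+1)
    pi_meas q z2 y l1 * (val z1 == N)%:R * pi_shift q l2 x z2 z1).
  apply: (graded_bridge (w2 := fun z _ => (z == N)%:R)
    hq h2 (graded_pi N hq h1) (graded_const q F (leqnn N))).
    by move=> z y yz; rewrite pi_meas_out.
  by move=> z y yN zy; rewrite ltn_eqF // (leq_trans zy).
move=> x y; rewrite mxE; have xN := ltn_ord x; have yN := ltn_ord y.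
under [RHS]eq_bigr => z2 _.
  under eq_bigr do rewrite -mulrA.
  rewrite -mulr_sumr (sum_ord_delta (fun z1 => pi_shift q l2 x z2 z1)) //.
  over.
apply: (sum_nat_ord (g := fun z => pi_meas q z y l1 * pi_shift q l2 x z N))
  => [|z zmin|z zN hz].
- lia.
- by rewrite /pi_shift ifT 1?mulrC //; lia.
have [yz|zy] := ltnP y z; first by rewrite pi_meas_out // mul0r.
by rewrite /pi_shift ifF ?mulr0 //; lia.
Qed.

(** A bridge whose lower end is pinned at [0]. *)
Lemma conv3_graded l1 l2 : admissible l1 -> admissible l2 ->
  exists2 w, graded w & forall x y, conv3 q N l1 l2 x y = w x y.
Proof.
move=> h1 h2; exists (fun x y => \sum_(z2 < N.+1) \sum_(z1 < N.+1)
    (val z2 == 0)%:R * pi_shift q l1 z1 y N * pi_shift q l2 x z2 z1).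
  apply: (graded_bridge (w1 := fun z _ => (z == 0)%:R)
    hq h2 (graded_const q F (leq0n N)) (graded_pi_shift N hq h1)).
    by case.
  by move=> z y _ zy; rewrite /pi_shift leqNgt zy.
move=> x y; rewrite mxE; have xN := ltn_ord x; have yN := ltn_ord y.
under [RHS]eq_bigr => z2 _.
  under eq_bigr do rewrite -mulrA.
  rewrite -mulr_sumr.
  over.
rewrite (sum_ord_delta (fun z2 => \sum_(z1 < N.+1)
  pi_shift q l1 z1 y N * pi_shift q l2 x z2 z1)) //.
apply: (sum_nat_ord (g := fun z => pi_shift q l1 z y N * pi_shift q l2 x 0 z))
  => [|z zmax|z zN hz] //.
- by rewrite /pi_shift leq0n !subn0 ifT 1?mulrC //; lia.
rewrite /pi_shift; case: leqP => yz; last by rewrite mul0r.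
by rewrite leq0n !subn0 (@pi_meas_out _ _ _ x) ?mulr0 //; lia.
Qed.

Section Linear.
Hypothesis hF : F <> QHahn.

Let etaE := grid_linear hF.

(** An independent sum: [z] is drawn from [y] and [x - z] from the reflected value [N - y]. *)
Lemma conv2_graded l1 l2 : admissible l1 -> admissible l2 ->
  exists2 w, graded w & forall x y, conv2 q N l1 l2 x y = w x y.
Proof.
move=> h1 h2; exists (fun x y => \sum_(z < N.+1) pi_meas q z y l1 *
   (if (z <= x)%N then pi_meas q (x - z) (N - y) l2 else 0)).
  apply: (graded_add (w2 := fun u y => pi_meas q u (N - y) l2) hq etaE
    (graded_pi N hq h1)
    (graded_reflect etaE (w := fun u y => pi_meas q u y l2) (graded_pi N hq h2))).
    by move=> z y yz; rewrite pi_meas_out.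
  by move=> u y _ yu; rewrite pi_meas_out.
move=> x y; rewrite mxE; have xN := ltn_ord x; have yN := ltn_ord y.
apply: (sum_nat_ord (g := fun z => pi_meas q z y l1 *
   (if (z <= x)%N then pi_meas q (x - z) (N - y) l2 else 0)))
   => [|z zmin|z zN hz].
- lia.
- by rewrite ifT 1?mulrC //; lia.
have [yz|zy] := ltnP y z; first by rewrite pi_meas_out // mul0r.
case: leqP => zx; last by rewrite mulr0.
by rewrite (@pi_meas_out _ _ _ (x - z)%N) ?mulr0 //; lia.
Qed.

(** As for [conv2], but the second summand is drawn from [N - y] in two stages, which gives the
    composed kernel [w2]. *)
Lemma conv5_graded l1 l2 l3 : admissible l1 -> admissible l2 -> admissible l3 ->
  exists2 w, graded w & forall x y, conv5 q N l1 l2 l3 x y = w x y.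
Proof.
move=> h1 h2 h3.
pose w2 u y := \sum_(v < N.+1) pi_meas q u v l3 * pi_meas q v (N - y) l2.
exists (fun x y => \sum_(z < N.+1) pi_meas q z y l1 *
   (if (z <= x)%N then w2 (x - z)%N y else 0)).
  apply: (graded_add (w2 := w2) hq etaE (graded_pi N hq h1)
   (graded_reflect etaE
     (w := fun u y => \sum_(v < N.+1) pi_meas q u v l3 * pi_meas q v y l2)
     (graded_comp (graded_pi N hq h3) (graded_pi N hq h2)))).
    by move=> z y yz; rewrite pi_meas_out.
  move=> u y _ yu; rewrite /w2 big1 // => v _.
  have [uv|vu] := leqP u v; last by rewrite pi_meas_out // mul0r.
  by rewrite (@pi_meas_out _ _ _ v) ?mulr0 // (leq_trans yu).
move=> x y; rewrite mxE; have xN := ltn_ord x; have yN := ltn_ord y.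
apply: (sum_nat_ord (g := fun z => pi_meas q z y l1 *
   (if (z <= x)%N then w2 (x - z)%N y else 0))) => [|z zmin|z zN hz].
- lia.
- rewrite ifT; last by lia.
  congr (_ * _).
  pose h v := pi_meas q (x - z) v l3 * pi_meas q v (N - y) l2.
  (* With [v = z1 - y] the lower bound on [z1] becomes [x - z <= v], the support condition of the
     first factor of [h]. *)
  transitivity (\sum_(z1 < N.+1) if (y <= z1)%N then h (z1 - y)%N else 0).
    apply: (sum_nat_ord (g := fun z1 => if (y <= z1)%N then h (z1 - y)%N else 0))
      => // [z1 hz1|z1 z1N hz1]; first by rewrite ifT //; lia.
    case: leqP => // yz1; rewrite /h pi_meas_out ?mul0r //; lia.
  rewrite (sum_ord_shift (fun z1 => h (z1 - y)%N)) // /w2.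
  rewrite (sum_ord_extend (m := (N - y).+1) (f := h)) //.
  - by apply: eq_bigr => u _; rewrite addKn.
  - lia.
  by move=> v vN yv; rewrite /h (@pi_meas_out _ _ _ v) ?mulr0.
have [yz|zy] := ltnP y z; first by rewrite pi_meas_out // mul0r.
by rewrite ifF ?mulr0 //; lia.
Qed.

End Linear.

Lemma generated_graded (K : 'M[R]_N.+1) : generated q F K ->
  exists2 w, graded w & forall x y, K x y = w x y.
Proof.
case=> *; [exact: conv1_graded|exact: conv2_graded|exact: conv3_graded|
  exact: conv4_graded|exact: conv5_graded].
Qed.

End Generated.

(** * Orthogonality of the polynomials *)

Section Polynomials.
Variable R : realType.
Implicit Types (a b q u v : R) (p : {poly R}) (M N : nat).

Lemma size_prod_linear (c : nat -> R) n :
  size (\prod_(i < n) ('X - (c i)%:P)) = n.+1.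
Proof.
by rewrite size_prod_XsubC /index_enum -enumT size_enum_ord.
Qed.

Definition rising_poly a j : {poly R} := \prod_(i < j) ('X - (- (a + i%:R))%:P).

Lemma size_rising_poly a j : size (rising_poly a j) = j.+1.
Proof. exact: (size_prod_linear (fun i => - (a + i%:R))). Qed.

Lemma horner_rising_poly a j y : (rising_poly a j).[y] = poch (a + y) j.
Proof.
rewrite horner_prod; apply: eq_bigr => i _; rewrite !hornerE; ring.
Qed.

(** At [q^-x] this is [q^(-jx) (a q^x; q)_j], the q-Hahn test function. *)
Definition qshift_poly a q j : {poly R} := \prod_(i < j) ('X - (a * q ^+ i)%:P).

Lemma size_qshift_poly a q j : size (qshift_poly a q j) = j.+1.
Proof. exact: (size_prod_linear (fun i => a * q ^+ i)). Qed.

Lemma horner_qshift_poly a q j y : y != 0 ->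
  (qshift_poly a q j).[y] = y ^+ j * qpoch (a / y) q j.
Proof.
move=> y0; elim: j => [|j IHj].
  by rewrite /qshift_poly big_ord0 qpoch0 hornerE mulr1.
rewrite /qshift_poly big_ord_recr /= hornerM -/(qshift_poly a q j) IHj.
by rewrite qpochS exprS hornerXsubC; field.
Qed.

Definition qpoch_poly a q j : {poly R} := \prod_(i < j) (1 - (a * q ^+ i) *: 'X).

(** Only a bound, because [a] may be zero. *)
Lemma size_qpoch_poly a q j : (size (qpoch_poly a q j) <= j.+1)%N.
Proof.
elim: j => [|j IHj]; first by rewrite /qpoch_poly big_ord0 size_poly1.
rewrite /qpoch_poly big_ord_recr /= -/(qpoch_poly a q j).
have : (size (1 - (a * q ^+ j) *: 'X : {poly R})%R <= 2)%N.
  rewrite (leq_trans (size_polyD _ _)) // geq_max size_poly1 size_polyN /=.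
  by rewrite (leq_trans (size_scale_leq _ _)) // size_polyX.
by move=> s2; apply: leq_trans (size_polyMleq _ _) _; lia.
Qed.

Lemma horner_qpoch_poly a q j y : (qpoch_poly a q j).[y] = qpoch (a * y) q j.
Proof.
rewrite horner_prod; apply: eq_bigr => i _; rewrite !hornerE; ring.
Qed.

Lemma poch_opp_fact n k : (k <= n)%N ->
  poch (- n%:R) k / k`!%:R = (-1) ^+ k * 'C(n, k)%:R :> R.
Proof.
move=> kn; have f0 : (k`!%:R : R) != 0 by rewrite pnatr_eq0 -lt0n fact_gt0.
apply: (canLR (mulfK f0)); rewrite -mulrA -natrM bin_ffact.
elim: k kn {f0} => [|k IHk] kn; first by rewrite poch0 mulr1.
rewrite pochS IHk 1?ltnW // ffactnSr natrM natrB 1?ltnW // exprS; ring.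
Qed.

(** An [n]-th difference of a polynomial of degree below [n]. On falling factorials it is a binomial
    moment with [u = -1] and [v = 1], which carries the factor [0^(n-j)] with [j < n]. *)
Lemma alternating_sum_eq0 n p : (size p <= n)%N ->
  \sum_(k < n.+1) poch (- n%:R) k / k`!%:R * p.[k%:R] = 0.
Proof.
move=> sp; pose S j : {poly R} := \prod_(i < j) ('X - i%:R%:P).
have [c ->] := poly_span (size_prod_linear (fun i => i%:R)) sp.
have hS j k : (S j).[k%:R] = (-1) ^+ j * poch (- k%:R) j.
  elim: j => [|j IHj]; first by rewrite /S big_ord0 poch0 hornerE mulr1.
  rewrite /S big_ord_recr /= hornerM -/(S j) IHj hornerXsubC exprS pochS; ring.
under eq_bigr do rewrite horner_sum mulr_sumr.
rewrite exchange_big big1 //= => j _.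
transitivity (c j * (-1) ^+ j * \sum_(k < n.+1) 'C(n, k)%:R *
  ((-1) ^+ k * 1 ^+ (n - k)) * poch (- k%:R) j).
  rewrite mulr_sumr; apply: eq_bigr => k _; have kn : (k <= n)%N by rewrite -ltnS.
  by rewrite hornerZ hS poch_opp_fact // expr1n; ring.
rewrite binomial_moment addNr expr0n subn_eq0 leqNgt ltn_ord /=.
by rewrite !mulr0.
Qed.

(** Induction on [n]: the coefficient recursion [rec] is multiplication of the generating polynomial
    by [1 - z q^-(n+1)]. *)
Lemma qbinomial_theorem q n z : 0 < q < 1 ->
  \sum_(k < n.+1) qpoch (q ^- n) q k / qpoch q q k * z ^+ k = qpoch (z * q ^- n) q n.
Proof.
move=> hq; have q0 : q != 0 by case/andP: hq => q0 _; rewrite gt_eqF.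
elim: n => [|n IHn].
  by rewrite big_ord1 !qpoch0 mulr1 divr1.
have nz k := qpochq_neq0 k hq.
have nzq k := expr_neq1 k hq.
have qnS : q ^- n.+1 * q = q ^- n by rewrite exprSr invfM -mulrA mulVf // mulr1.
have rec k : qpoch (q ^- n.+1) q k.+1 / qpoch q q k.+1 =
    qpoch (q ^- n) q k.+1 / qpoch q q k.+1
    - q ^- n.+1 * (qpoch (q ^- n) q k / qpoch q q k).
  rewrite (qpochSl (q ^- n.+1)) qnS qpochqS (qpochS (q ^- n)) -qnS.
  by rewrite (exprS q k); field; rewrite -exprS nz nzq expf_neq0.
have vanish : qpoch (q ^- n) q n.+1 = 0 by rewrite qpoch_inv_eq0.
rewrite qpochSl -(mulrA z) qnS -IHn mulrBl mul1r.
rewrite big_ord_recl /= !qpoch0.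
under eq_bigr do rewrite /bump /= add1n rec mulrBl.
rewrite big_split /= addrA; congr (_ + _).
  rewrite [RHS]big_ord_recl /= !qpoch0; congr (_ + _).
  by rewrite big_ord_recr /= vanish !mul0r addr0.
rewrite mulr_sumr -sumrN; apply: eq_bigr => k _.
by rewrite (exprS z); ring.
Qed.

(** On the monomial of degree [i < n] the q-binomial theorem with [z = q^(i+1)] gives
    [(q^-(n-i-1); q)_n], which contains a zero factor. *)
Lemma qalternating_sum_eq0 q n p : 0 < q < 1 -> (size p <= n)%N ->
  \sum_(k < n.+1) qpoch (q ^- n) q k / qpoch q q k * q ^+ k * p.[q ^+ k] = 0.
Proof.
move=> hq sp; under eq_bigr do rewrite horner_coef mulr_sumr.
have q0 : q != 0 by case/andP: hq => q0 _; rewrite gt_eqF.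
rewrite exchange_big big1 //= => i _.
transitivity (p`_i * \sum_(k < n.+1) qpoch (q ^- n) q k / qpoch q q k
                                   * (q ^+ i.+1) ^+ k).
  rewrite mulr_sumr; apply: eq_bigr => k _.
  by rewrite -exprM mulSn exprD mulnC exprM; ring.
have ni : (i < n)%N by rewrite (leq_trans (ltn_ord i)).
have e : q ^+ i.+1 / q ^+ n = q ^- (n - i.+1).
  by rewrite -[in LHS](subnKC ni) exprD; field; rewrite !expf_neq0.
by rewrite qbinomial_theorem // e qpoch_inv_eq0 ?mulr0 //; lia.
Qed.

(** Absorption removes the factors in [x]; the base case [k = 0] is the single moment after the
    reflection [x -> M - x]. *)
Lemma binomial_joint_moment u v M j k :
  \sum_(x < M.+1) 'C(M, x)%:R * (u ^+ x * v ^+ (M - x))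
     * poch (- x%:R) k * poch (- (M - x)%:R) j
  = u ^+ k * v ^+ j * poch (- M%:R) (k + j) * (u + v) ^+ (M - (k + j)).
Proof.
elim: k M => [|k IHk] M.
  rewrite (reindex_inj rev_ord_inj) /=.
  transitivity (\sum_(x < M.+1) 'C(M, x)%:R * (v ^+ x * u ^+ (M - x)) * poch (- x%:R) j).
    apply: eq_bigr => x _; have xM : (x <= M)%N by rewrite -ltnS.
    by rewrite !subSS subKn // bin_sub // poch0; ring.
  by rewrite binomial_moment addrC expr0 mul1r.
rewrite big_ord_recl /= oppr0 pochSl !mul0r mulr0 mul0r add0r.
case: M => [|M]; first by rewrite big_ord0 addSn pochSl oppr0 mul0r mulr0 mul0r.
rewrite addSn pochSl opp_nat_succ subSS.
transitivity (- M.+1%:R * u * (u ^+ k * v ^+ j * poch (- M%:R) (k + j) *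
   (u + v) ^+ (M - (k + j)))).
  rewrite -IHk mulr_sumr; apply: eq_bigr => x _.
  rewrite /bump /= add1n subSS pochSl opp_nat_succ exprS.
  have := mul_bin_diag M.+1 x; rewrite /= => /(congr1 (fun n => n%:R : R)).
  rewrite !natrM => e.
  transitivity (- (x.+1%:R * 'C(M.+1, x.+1)%:R) * (u * u ^+ x * v ^+ (M - x)) *
     poch (- x%:R) k * poch (- (M - x)%:R) j); first by ring.
  by rewrite -e; ring.
by rewrite (exprS u k); ring.
Qed.

End Polynomials.

(** * Orthogonality to lower degrees, family by family *)

Section Orthogonality.
Variables (R : realType) (q : R) (N : nat).
Hypothesis hq : 0 < q < 1.
Implicit Types (F : ortho_family).

Let q0 : q != 0. Proof. by case/andP: hq => q0 _; rewrite gt_eqF. Qed.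

Definition Pcheck_coef F (n k : nat) : fparam R F -> R :=
  match F return fparam R F -> R with
  | Krawtchouk => fun p => poch (- n%:R) k / (poch (- N%:R) k * k`!%:R) * p ^- k
  | Hahn => fun l => let: (a, b) := l in
      poch (- n%:R) k * poch (n%:R + a + b - 1) k
        / (poch a k * poch (- N%:R) k * k`!%:R)
  | QHahn => fun l => let: (a, b) := l in
      qpoch (q ^- n) q k * qpoch (a * b * q ^+ n / q) q k
        / (qpoch a q k * qpoch (q ^- N) q k * qpoch q q k) * q ^+ k
  end.

Lemma PcheckE F n x (l : fparam R F) : Pcheck q N n x l =
  \sum_(k < n.+1) Pcheck_coef n k l * (poch_poly q F k).[grid q F x].
Proof.
by case: F l => [p|[a b]|[a b]]; apply: eq_bigr => k _;
  [rewrite (horner_poch_poly q Krawtchouk)|rewrite (horner_poch_poly q Hahn)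
  |rewrite (horner_poch_poly q QHahn)] => /=; ring.
Qed.

Lemma Pcheck_poly F n (l : fparam R F) : poly_in (grid q F) N n
  (fun x => Pcheck q N n x l).
Proof.
exists (\sum_(k < n.+1) Pcheck_coef n k l *: poch_poly q F k) => [|x _].
  apply: leq_trans (size_sum _ _ _) _; apply/bigmax_leqP => k _.
  by rewrite (leq_trans (size_scale_leq _ _)) // size_poch_poly.
by rewrite PcheckE horner_sum; apply: eq_bigr => k _; rewrite hornerZ.
Qed.

Lemma Pcheck0 F n (l : fparam R F) : Pcheck q N n 0 l = 1.
Proof.
rewrite PcheckE big_ord_recl big1 /= => [|k _]; last first.
  rewrite horner_poch_poly /bump /= add1n.
  by case: F l => l; rewrite ?(@poch_opp_nat_eq0 R 0) ?qpoch_inv_eq0 ?mulr0.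
rewrite horner_poch_poly addr0.
case: F l => [p|[a b]|[a b]] /=; rewrite ?poch0 ?qpoch0 ?expr0 ?invr1 ?mulr1 //.
- by rewrite divr1.
- by rewrite divr1.
by rewrite divr1.
Qed.

Lemma pi_meas_gt0 F x (l : fparam R F) : admissible l -> (x <= N)%N ->
  0 < pi_meas q x N l.
Proof.
case: F l => [p|[a b]|[a b]] /= hl xN; rewrite xN.
- by rewrite !mulr_gt0 ?exprn_gt0 ?ltr0n ?bin_gt0 //; lra.
- case: hl => a0 b0.
  by rewrite mulr_gt0 ?divr_gt0 ?mulr_gt0 ?poch_gt0 ?addr_gt0 ?ltr0n ?bin_gt0.
case: hl => /andP[a0 a1] b1; have [_ q1] := andP hq.
have ab1 : a * b < 1 by nra.
by rewrite mulr_gt0 ?divr_gt0 ?mulr_gt0 ?qpoch_gt0 ?exprn_gt0.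
Qed.

(** Exchanging the sums over [x] and [k] lets each family choose test polynomials [S j] for which
    the sum over [x] has a closed form. *)
Lemma orthogonal_of_basis F n (l : fparam R F) (S : nat -> {poly R}) :
  (forall j, size (S j) = j.+1) ->
  (forall j, (j < n)%N ->
    \sum_(k < n.+1) Pcheck_coef n k l * (\sum_(x < N.+1) pi_meas q x N l *
        (poch_poly q F k).[grid q F x] * (S j).[grid q F x]) = 0) ->
  forall p : {poly R}, (size p <= n)%N ->
    \sum_(x < N.+1) pi_meas q x N l * Pcheck q N n x l * p.[grid q F x] = 0.
Proof.
move=> sS hS p sp; have [c ->] := poly_span sS sp.
under eq_bigr do rewrite horner_sum mulr_sumr.
rewrite exchange_big big1 //= => j _.
rewrite -[RHS](mulr0 (c j)) -[X in _ = _ * X](hS j) // mulr_sumr.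
under [RHS]eq_bigr do rewrite !mulr_sumr.
rewrite [RHS]exchange_big; apply: eq_bigr => x _ /=.
rewrite PcheckE hornerZ mulr_sumr mulr_suml; apply: eq_bigr => k _; ring.
Qed.

(** The joint moment cancels [p^-k] and the denominator [(-N)_k], leaving [(k - N)_j], of degree
    [j < n] in [k]. *)
Lemma krawtchouk_orthogonal n (l : fparam R Krawtchouk) (p : {poly R}) :
  admissible l -> (n <= N)%N -> (size p <= n)%N ->
  \sum_(x < N.+1) pi_meas q x N l * Pcheck q N n x l * p.[grid q Krawtchouk x] = 0.
Proof.
move=> hl nN; apply: (orthogonal_of_basis (size_rising_poly (- N%:R))) => j jn.
rewrite /= in l hl *.
transitivity ((1 - l) ^+ j * \sum_(k < n.+1)
    poch (- n%:R) k / k`!%:R * (rising_poly (- N%:R) j).[k%:R]).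
  rewrite mulr_sumr; apply: eq_bigr => k _.
  have kN : (k <= N)%N by rewrite (leq_trans _ nN) // -ltnS.
  have -> : \sum_(x < N.+1) (if (x <= N)%N then 'C(N, x)%:R * l ^+ x *
      (1 - l) ^+ (N - x) else 0) * (poch_poly q Krawtchouk k).[x%:R] *
      (rising_poly (- N%:R) j).[x%:R]
    = l ^+ k * (1 - l) ^+ j * poch (- N%:R) (k + j).
    rewrite -[RHS]mulr1 -[X in _ * X](expr1n _ (N - (k + j))).
    rewrite -[X in _ * X ^+ _](subrKC l) -binomial_joint_moment.
    apply: eq_bigr => x _; have xN : (x <= N)%N by rewrite -ltnS.
    rewrite xN (horner_poch_poly q Krawtchouk) horner_rising_poly natrB //.
    by rewrite opprB [_ - N%:R]addrC; ring.
  have f0 : (k`!%:R : R) != 0 by rewrite pnatr_eq0 -lt0n fact_gt0.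
  have l0 : l != 0 by rewrite gt_eqF //; case/andP: hl.
  rewrite pochD horner_rising_poly.
  by field; rewrite f0 poch_opp_nat_neq0 // expf_neq0.
by rewrite alternating_sum_eq0 ?mulr0 // size_rising_poly.
Qed.

Lemma hahn_orthogonal n (l : fparam R Hahn) (p : {poly R}) :
  admissible l -> (n <= N)%N -> (size p <= n)%N ->
  \sum_(x < N.+1) pi_meas q x N l * Pcheck q N n x l * p.[grid q Hahn x] = 0.
Proof.
case: l => a b [/= a0 b0] nN.
apply: (orthogonal_of_basis (F := Hahn) (l := (a, b)) (size_rising_poly a)) => j jn.
have c0 : 0 < a + b by rewrite addr_gt0.
(* What remains of the dependence on [k] after all cancellations; its degree is
   [j + (n-1-j) = n-1]. *)
pose r := rising_poly a j * rising_poly (a + b + j%:R) (n.-1 - j).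
have r_size : (size r <= n)%N.
  apply: leq_trans (size_polyMleq _ _) _; rewrite !size_rising_poly.
  by move: jn; lia.
have mass0 : poch (a + b) N != 0 by rewrite gt_eqF ?poch_gt0.
have shift0 : poch (a + b + j%:R) (n.-1 - j) != 0.
  by rewrite gt_eqF // poch_gt0 // ltr_wpDr.
transitivity (poch (a + b + j%:R) N / (poch (a + b) N *
   poch (a + b + j%:R) (n.-1 - j)) *
   \sum_(k < n.+1) poch (- n%:R) k / k`!%:R * r.[k%:R]); last first.
  by rewrite alternating_sum_eq0 ?mulr0.
rewrite mulr_sumr; apply: eq_bigr => k _ /=.
have kN : (k <= N)%N by rewrite (leq_trans _ nN) // -ltnS.
have -> : \sum_(x < N.+1) (if (x <= N)%N then 'C(N, x)%:R *
     (poch a x * poch b (N - x) / poch (a + b) N) else 0) *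
     (poch_poly q Hahn k).[x%:R] * (rising_poly a j).[x%:R]
   = poch a j / poch (a + b) N * (poch (a + j%:R) k * poch (- N%:R) k
       * poch (a + j%:R + b + k%:R) (N - k)).
  rewrite -vandermonde_moment mulr_sumr; apply: eq_bigr => x _.
  have xN : (x <= N)%N by rewrite -ltnS.
  rewrite xN (horner_poch_poly q Hahn) horner_rising_poly.
  have e : poch a x * poch (a + x%:R) j = poch a j * poch (a + j%:R) x.
    by rewrite -!pochD addnC.
  transitivity ('C(N, x)%:R * (poch a x * poch (a + x%:R) j) * poch b (N - x)
     / poch (a + b) N * poch (- x%:R) k); first by ring.
  by rewrite e; ring.
rewrite /r hornerM !horner_rising_poly.
have a_k : poch a k != 0 by rewrite gt_eqF ?poch_gt0.
have f0 : (k`!%:R : R) != 0 by rewrite pnatr_eq0 -lt0n fact_gt0.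
have e1 : poch a j * poch (a + j%:R) k = poch a k * poch (a + k%:R) j.
  by rewrite -!pochD addnC.
(* With [c = a+b+j] and [m = n-1-j], the middle symbol starts at [c + m]. So the first two merge
   into [(c)_(m+k)], which is split again at [k], and [(c)_k (c+k)_(N-k) = (c)_N]. *)
have e2 : poch (a + b + j%:R) (n.-1 - j) * poch (n%:R + a + b - 1) k *
    poch (a + j%:R + b + k%:R) (N - k)
  = poch (a + b + j%:R) N * poch (a + b + j%:R + k%:R) (n.-1 - j).
  have -> : n%:R + a + b - 1 = a + b + j%:R + (n.-1 - j)%:R.
    rewrite -{1}(ltn_predK jn) natrB -?natr1; last by rewrite -ltnS (ltn_predK jn).
    by ring.
  have -> : a + j%:R + b + k%:R = a + b + j%:R + k%:R by ring.
  rewrite -pochD addnC pochD mulrAC; congr (_ * _).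
  by rewrite -pochD subnKC.
transitivity (poch (- n%:R) k / (poch a k * k`!%:R) *
  (poch a j * poch (a + j%:R) k) * (poch (n%:R + a + b - 1) k
    * poch (a + j%:R + b + k%:R) (N - k)) / poch (a + b) N).
  by field; rewrite f0 mass0 a_k poch_opp_nat_neq0.
rewrite e1.
transitivity (poch (- n%:R) k / k`!%:R * poch (a + k%:R) j *
  (poch (a + b + j%:R) (n.-1 - j) * poch (n%:R + a + b - 1) k *
    poch (a + j%:R + b + k%:R) (N - k))
   / (poch (a + b) N * poch (a + b + j%:R) (n.-1 - j))).
  by field; rewrite f0 mass0 a_k shift0.
by rewrite e2; field; rewrite f0 mass0 shift0.
Qed.

Lemma qhahn_orthogonal n (l : fparam R QHahn) (p : {poly R}) :
  admissible l -> (n <= N)%N -> (size p <= n)%N ->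
  \sum_(x < N.+1) pi_meas q x N l * Pcheck q N n x l * p.[grid q QHahn x] = 0.
Proof.
case: l => a b [/= /andP[a0 a1] b1] nN.
apply: (orthogonal_of_basis (F := QHahn) (l := (a, b))
  (size_qshift_poly a q)) => j jn.
have ab1 : a * b < 1 by have [_ q1] := andP hq; nra.
have abq i : a * b * q ^+ i < 1.
  have qi0 : 0 < q ^+ i by rewrite exprn_gt0 //; case/andP: hq.
  have qi1 : q ^+ i <= 1 by case/andP: hq => *; rewrite exprn_ile1 // ltW.
  by case: (lerP 0 (a * b)) => ab0; nra.
(* The q-analogue of the Hahn remainder, now a polynomial in [q^k]. *)
pose r := qpoch_poly a q j * qpoch_poly (a * b * q ^+ j) q (n.-1 - j).
have r_size : (size r <= n)%N.
  apply: leq_trans (size_polyMleq _ _) _.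
  have := size_qpoch_poly a q j.
  by have := size_qpoch_poly (a * b * q ^+ j) q (n.-1 - j); move: jn; lia.
have mass0 : qpoch (a * b) q N != 0 by rewrite gt_eqF ?qpoch_gt0.
have shift0 : qpoch (a * b * q ^+ j) q (n.-1 - j) != 0 by rewrite gt_eqF ?qpoch_gt0.
transitivity (q ^- (N * j) * qpoch (a * b * q ^+ j) q N / (qpoch (a * b) q N *
   qpoch (a * b * q ^+ j) q (n.-1 - j)) *
   \sum_(k < n.+1) qpoch (q ^- n) q k / qpoch q q k * q ^+ k * r.[q ^+ k]); last first.
  by rewrite qalternating_sum_eq0 ?mulr0.
rewrite mulr_sumr; apply: eq_bigr => k _ /=.
have kN : (k <= N)%N by rewrite (leq_trans _ nN) // -ltnS.
have -> : \sum_(x < N.+1) (if (x <= N)%N then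
     qpoch q q N / (qpoch q q x * qpoch q q (N - x)) *
     (qpoch a q x * qpoch b q (N - x) * a ^+ (N - x) / qpoch (a * b) q N) else 0) *
     (poch_poly q QHahn k).[q ^- x] * (qshift_poly a q j).[q ^- x]
   = qpoch a q j * q ^- (N * j) / qpoch (a * b) q N *
      (qpoch (a * q ^+ j) q k * qpoch (q ^- N) q k
       * qpoch (a * q ^+ j * b * q ^+ k) q (N - k)).
  rewrite -qvandermonde_moment // mulr_sumr; apply: eq_bigr => x _.
  have xN : (x <= N)%N by rewrite -ltnS.
  rewrite xN (horner_poch_poly q QHahn) horner_qshift_poly ?invr_eq0 ?expf_neq0 //.
  rewrite invrK -/(qbinom q N x).
  have e : qpoch a q x * qpoch (a * q ^+ x) q j = qpoch a q j * qpoch (a * q ^+ j) q x.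
    by rewrite -!qpochD addnC.
  (* This turns the weight [a^(N-x)] into [(a q^j)^(N-x)], as the moment formula with parameter
     [a q^j] demands. *)
  have e' : q ^- x ^+ j = q ^- (N * j) * (q ^+ j) ^+ (N - x).
    rewrite -exprM mulnBr exprVn -exprM (mulnC j N) (mulnC j x).
    rewrite -[in RHS](subnKC (leq_mul xN (leqnn j))) exprD addKn.
    by field; rewrite !expf_neq0.
  transitivity (qbinom q N x * (qpoch a q x * qpoch (a * q ^+ x) q j) *
     qpoch b q (N - x) * a ^+ (N - x) * q ^- x ^+ j
     / qpoch (a * b) q N * qpoch (q ^- x) q k); first by ring.
  by rewrite e e' exprMn; ring.
rewrite /r hornerM !horner_qpoch_poly.
have a_k : qpoch a q k != 0 by rewrite gt_eqF ?qpoch_gt0.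
have f0 : qpoch q q k != 0 by rewrite qpochq_neq0.
have e1 : qpoch a q j * qpoch (a * q ^+ j) q k = qpoch a q k * qpoch (a * q ^+ k) q j.
  by rewrite -!qpochD addnC.
have e2 : qpoch (a * b * q ^+ j) q (n.-1 - j) * qpoch (a * b * q ^+ n / q) q k *
    qpoch (a * q ^+ j * b * q ^+ k) q (N - k)
  = qpoch (a * b * q ^+ j) q N * qpoch (a * b * q ^+ j * q ^+ k) q (n.-1 - j).
  have -> : a * b * q ^+ n / q = a * b * q ^+ j * q ^+ (n.-1 - j).
    rewrite -[RHS]mulrA -exprD subnKC; last by rewrite -ltnS (ltn_predK jn).
    by rewrite -{1}(ltn_predK jn) exprSr; field.
  have -> : a * q ^+ j * b * q ^+ k = a * b * q ^+ j * q ^+ k by ring.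
  rewrite -qpochD addnC qpochD mulrAC; congr (_ * _).
  by rewrite -qpochD subnKC.
transitivity (q ^- (N * j) * qpoch (q ^- n) q k / (qpoch a q k * qpoch q q k) * q ^+ k *
  (qpoch a q j * qpoch (a * q ^+ j) q k) * (qpoch (a * b * q ^+ n / q) q k
    * qpoch (a * q ^+ j * b * q ^+ k) q (N - k)) / qpoch (a * b) q N).
  move: (qpoch_inv_neq0 hq kN) (q ^- (N * j)) => qN0 t.
  by field; rewrite f0 mass0 a_k.
rewrite e1.
transitivity (q ^- (N * j) * (qpoch (q ^- n) q k / qpoch q q k * q ^+ k) *
  qpoch (a * q ^+ k) q j *
  (qpoch (a * b * q ^+ j) q (n.-1 - j) * qpoch (a * b * q ^+ n / q) q k *
    qpoch (a * q ^+ j * b * q ^+ k) q (N - k))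
   / (qpoch (a * b) q N * qpoch (a * b * q ^+ j) q (n.-1 - j))).
  move: (q ^- (N * j)) => t.
  by field; rewrite f0 mass0 a_k shift0.
rewrite e2; move: (q ^- (N * j)) => t.
by field; rewrite f0 mass0 shift0.
Qed.

Lemma Pcheck_orthogonal F n (l : fparam R F) (p : {poly R}) :
  admissible l -> (n <= N)%N -> (size p <= n)%N ->
  \sum_(x < N.+1) pi_meas q x N l * Pcheck q N n x l * p.[grid q F x] = 0.
Proof.
case: F l => l; [exact: krawtchouk_orthogonal|exact: hahn_orthogonal|
  exact: qhahn_orthogonal].
Qed.

End Orthogonality.

(** * Spectral representation *)

Section Spectral.
Variables (R : realType) (q : R) (N : nat) (F : ortho_family).
Hypothesis hq : 0 < q < 1.
Variable l : fparam R F.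
Hypothesis hl : admissible l.
Local Notation pi_ x := (pi_meas q x N l).
Local Notation P n x := (Pcheck q N n x l).
Local Notation graded := (graded (grid q F) N).

Lemma orthogonal_lower_degree m n (f : nat -> R) :
  (m < n)%N -> (n <= N)%N -> poly_in (grid q F) N m f ->
  \sum_(x < N.+1) pi_ x * P n x * f x = 0.
Proof.
move=> mn nN [p sp fp]; rewrite -[RHS](Pcheck_orthogonal hq hl nN (leq_trans sp mn)).
by apply: eq_bigr => x _; rewrite fp // -ltnS.
Qed.

(** The normalisation at [0] makes the term [x = 0] equal to the positive mass there. *)
Lemma Pcheck_norm_gt0 n : 0 < \sum_(x < N.+1) pi_ x * P n x * P n x.
Proof.
rewrite big_ord_recl /= Pcheck0 // !mulr1 ltr_wpDr ?pi_meas_gt0 //.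
apply: sumr_ge0 => x _; rewrite -mulrA mulr_ge0 -?expr2 ?sqr_ge0 //.
by rewrite ltW // pi_meas_gt0.
Qed.

Lemma Pcheck_pair_orthogonal m n : (m <= N)%N -> (n <= N)%N -> m != n ->
  \sum_(x < N.+1) pi_ x * P m x * P n x = 0.
Proof.
move=> mN nN; rewrite neq_ltn => /orP[mn|nm]; last first.
  exact: (orthogonal_lower_degree (f := fun x => P n x) nm mN (Pcheck_poly N hq n l)).
rewrite -[RHS](orthogonal_lower_degree mn nN (Pcheck_poly N hq m l)).
by apply: eq_bigr => x _; rewrite mulrAC.
Qed.

Lemma dnP (n : 'I_N.+1) : 0 < dn q l n /\
  forall m : 'I_N.+1, \sum_(x < N.+1) pi_ x * P m x * P n x
    = (m == n)%:R / dn q l n ^+ 2.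
Proof.
rewrite /dn; set A := (A in xget 0 A); suff : A (xget 0 A) by [].
apply: xgetPex; have s0 := Pcheck_norm_gt0 n.
(* The inverse norm inhabits the defining set, so the default value 0 of [xget] is not taken. *)
exists (Num.sqrt (\sum_(x < N.+1) pi_ x * P n x * P n x))^-1.
split=> [|m]; first by rewrite invr_gt0 sqrtr_gt0.
rewrite exprVn invrK sqr_sqrtr ?(ltW s0) //.
case: eqVneq => [->|mn]; first by rewrite mul1r.
by rewrite mul0r Pcheck_pair_orthogonal // -ltnS.
Qed.

Lemma phi0_gt0 (x : 'I_N.+1) : 0 < phi0 q l x.
Proof. by rewrite sqrtr_gt0 pi_meas_gt0 // -ltnS. Qed.

Lemma phi0_sq (x : 'I_N.+1) : phi0 q l x * phi0 q l x = pi_ x.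
Proof. by rewrite -expr2 sqr_sqrtr // ltW // pi_meas_gt0 // -ltnS. Qed.

Lemma phi_orthonormal (m n : 'I_N.+1) :
  \sum_(x < N.+1) phi q l m x * phi q l n x = (m == n)%:R.
Proof.
have [dn0 dnE] := dnP n.
transitivity (dn q l m * dn q l n * \sum_(x < N.+1) pi_ x * P m x * P n x).
  rewrite mulr_sumr; apply: eq_bigr => x _.
  by rewrite -phi0_sq /phi; ring.
rewrite dnE; case: eqVneq => [->|_]; last by rewrite mul0r mulr0.
by field; rewrite gt_eqF.
Qed.

(** Orthonormality says [Phi *m Phi^T = 1]; for square matrices the reversed product is then the
    identity as well. *)
Lemma phi_complete (x y : 'I_N.+1) :
  \sum_(n < N.+1) phi q l n x * phi q l n y = (x == y)%:R.
Proof.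
pose Phi : 'M[R]_N.+1 := \matrix_(n, x) phi q l n x.
have PhiK : Phi *m Phi^T = 1%:M.
  apply/matrixP => m n; rewrite !mxE -phi_orthonormal.
  by apply: eq_bigr => z _; rewrite !mxE.
have /matrixP/(_ x y) := mulmx1C PhiK; rewrite !mxE => <-.
by apply: eq_bigr => z _; rewrite !mxE.
Qed.

Variable K : 'M[R]_N.+1.
Hypotheses (hK : generated q F K) (hrev : detailed_balance q K l).

Lemma transpose_poly n : exists2 f : nat -> R, poly_in (grid q F) N n f &
  forall x : 'I_N.+1, f x = \sum_(y < N.+1) K y x * P n y.
Proof.
have [w gw wE] := generated_graded hq hK.
exists (fun x => \sum_(y < N.+1) w y x * P n y) => [|x].
  exact: (graded_apply gw (Pcheck_poly N hq n l)).
by apply: eq_bigr => y _; rewrite wE.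
Qed.

(* [K^T] preserves the degree and, by detailed balance, is self-adjoint for
   [pi]. *)
Lemma transpose_Pcheck_orthogonal (m n : 'I_N.+1) : m != n ->
  \sum_(x < N.+1) pi_ x * P m x * (\sum_(y < N.+1) K y x * P n y) = 0.
Proof.
rewrite neq_ltn => /orP[mn|nm]; last first.
  have [f pf fE] := transpose_poly n.
  have mN : (m <= N)%N by rewrite -ltnS.
  rewrite -[RHS](orthogonal_lower_degree nm mN pf).
  by apply: eq_bigr => x _; rewrite fE.
have [f pf fE] := transpose_poly m.
have nN : (n <= N)%N by rewrite -ltnS.
rewrite -[RHS](orthogonal_lower_degree mn nN pf).
under eq_bigr do rewrite mulr_sumr.
rewrite exchange_big; apply: eq_bigr => y _ /=; rewrite fE mulr_sumr.
apply: eq_bigr => x _.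
transitivity (K y x * pi_ x * (P m x * P n y)); first by ring.
by rewrite -hrev; ring.
Qed.

Lemma kappaP (n x : 'I_N.+1) :
  \sum_(y < N.+1) K x y * (pi_ y * P n y) = kappa q K l n * (pi_ x * P n x).
Proof.
move: x; rewrite /kappa; set A := (A in xget 0 A); suff : A (xget 0 A) by [].
apply: xgetPex.
pose g x := \sum_(y < N.+1) K y x * P n y.
(* The coefficient along [P n] of [g], the image of [P n] under the transpose of [K]; the other
   coefficients vanish. *)
exists (dn q l n ^+ 2 * \sum_(x < N.+1) pi_ x * P n x * g x) => x.
have phi0N0 : phi0 q l x != 0 by rewrite gt_eqF // phi0_gt0.
have expand : phi0 q l x * g x = \sum_(m < N.+1) phi q l m x *
    (dn q l m * \sum_(z < N.+1) pi_ z * P m z * g z).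
  transitivity (\sum_(z < N.+1) (x == z)%:R * (phi0 q l z * g z)).
    rewrite (bigD1 x) //= eqxx mul1r big1 ?addr0 // => z.
    by rewrite eq_sym => /negbTE ->; rewrite mul0r.
  under eq_bigr do rewrite -phi_complete mulr_suml.
  rewrite exchange_big; apply: eq_bigr => m _ /=; rewrite !mulr_sumr.
  by apply: eq_bigr => z _; rewrite -phi0_sq /phi; ring.
have gE : g x = dn q l n ^+ 2 * (\sum_(z < N.+1) pi_ z * P n z * g z) * P n x.
  apply: (mulfI phi0N0); rewrite expand (bigD1 n) //= [X in _ + X]big1 => [|m mn].
    by rewrite addr0 /phi; ring.
  by rewrite transpose_Pcheck_orthogonal // !mulr0.
(* Detailed balance turns [K] applied to [pi P n] into [pi] times the transpose of [K] applied to
   [P n]. *)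
transitivity (pi_ x * g x); last by rewrite gE; ring.
rewrite /g mulr_sumr; apply: eq_bigr => y _.
by rewrite !mulrA hrev; ring.
Qed.

(** Conjugation by [phi0] makes each [phi n] an eigenvector of [Hmat] with eigenvalue [kappa n];
    completeness then collapses the sum over [n] to the entry at [y]. *)
Lemma Hmat_spectral (x y : 'I_N.+1) : Hmat q K l x y =
  \sum_(n < N.+1) kappa q K l n * phi q l n x * phi q l n y.
Proof.
have p0 (z : 'I_N.+1) : phi0 q l z != 0 by rewrite gt_eqF // phi0_gt0.
have eigen (n : 'I_N.+1) : \sum_(z < N.+1) Hmat q K l x z * phi q l n z
    = kappa q K l n * phi q l n x.
  apply: (mulfI (p0 x)).
  transitivity (dn q l n * \sum_(z < N.+1) K x z * (pi_ z * P n z)).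
    rewrite !mulr_sumr; apply: eq_bigr => z _.
    by rewrite mxE -phi0_sq /phi; field.
  by rewrite kappaP -phi0_sq /phi; ring.
under eq_bigr do rewrite -eigen mulr_suml.
rewrite exchange_big /= (bigD1 y) //=.
have delta (z : 'I_N.+1) : \sum_(n < N.+1) Hmat q K l x z * phi q l n z * phi q l n y
   = Hmat q K l x z * (z == y)%:R.
  by rewrite -phi_complete mulr_sumr; apply: eq_bigr => n _; rewrite mulrA.
rewrite delta eqxx mulr1 big1 ?addr0 // => z /negbTE zy.
by rewrite delta zy mulr0.
Qed.

End Spectral.

Theorem theorem2p3 (R : realType) (q : R) (hq : 0 < q < 1)
    (N : nat) (hN : (1 <= N)%N) (F : ortho_family)
    (K : 'M[R]_N.+1) (hK : generated q F K)
    (l : fparam R F) (hl : admissible l) (hrev : detailed_balance q K l) :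
  forall x y : 'I_N.+1,
    [/\ Hmat q K l x y
          = \sum_(n : 'I_N.+1) kappa q K l n * phi q l n x * phi q l n y,
        K x y
          = phi0 q l x
            * (\sum_(n : 'I_N.+1) kappa q K l n * phi q l n x * phi q l n y)
            * (phi0 q l y)^-1
      & K x y
          = \sum_(n : 'I_N.+1) kappa q K l n * dn q l n ^+ 2
              * pi_meas q x N l * Pcheck q N n x l * Pcheck q N n y l].
Proof.
move=> x y.
have HE := Hmat_spectral hq hl hK hrev x y.
have p0 (z : 'I_N.+1) : phi0 q l z != 0 by rewrite gt_eqF // phi0_gt0.
have KE : K x y = phi0 q l x
    * (\sum_(n : 'I_N.+1) kappa q K l n * phi q l n x * phi q l n y)
    * (phi0 q l y)^-1.
  by rewrite -HE mxE; field; rewrite !p0.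
(* The two factors [phi0 x] combine to the mass at [x], while [phi0 y] cancels. *)
split=> //; rewrite KE mulr_sumr mulr_suml; apply: eq_bigr => n _.
by rewrite -(phi0_sq hq hl x) /phi; field.
Qed.
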